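(* Every real Markov topograph $\mathcal G$ with labels in $(-\infty,-2]\cup[2,\infty)$ takes one of the following distinct forms, or is a sign variant of a topograph of one of these forms: (i) A topograph with a vertex well or an edge well. Hence $D<4$ and it has no $2$-regions. (ii) A topograph with all regions labeled $2$, so that $D=4$. (iii) A topograph with $D=4$ and at most one $2$-region. Fixing any edge $e$, it consists of a strictly rising tree going one way from $e$ and a leveling tree going the other way (or two leveling trees if $e$ is adjacent to a $2$-region). Moreover: (a) if the topograph is rational then it has one $2$-region and has repeated numbers on every subtree; (b) if it is irrational then it has no $2$-regions and no repeated numbers. (iv) A topograph with a negative vertex well. Hence $D\ge20$ and it has up to three regions with absolute value $2$: they must be adjacent to the well.
   Context: A real Markov topograph $\mathcal G$ is an infinite 3-regular tree drawn in the plane, with a real label on every complementary region, such that for every edge, with regions $s,t$ on its two sides and regions $r,u$ at its two ends, $r+u=st$. Regions are referred to by their labels (which need not be distinct); a $2$-region is a region with label $2$. The discriminator is $D=r^2+s^2+t^2-rst$ for the labels $r,s,t$ meeting at a vertex (independent of the vertex). An edge with regions $r,u$ at its ends, directed from $r$ to $u$, has label $u-r$; its positive direction is the one making the label positive (edges with label $0$ are undirected). If all regions are $\ge2$: a vertex well is a vertex all of whose edges are positively directed out from it; an edge well is a $0$-labeled edge whose two adjacent (side) regions are both $>2$. A negative vertex well (in any topograph) is a vertex whose three neighbouring regions are all $\le-2$. Sign variants: the regions have a 3-colouring (unique up to permuting colours) in which adjacent regions have different colours; a sign variant is obtained by picking two colours and changing the signs of all regions with those colours. Subtrees: cutting $\mathcal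 G$ at an edge $e$ with side regions $s,t$ and end regions $u,r$ gives two rooted trees, one on each side, with root on $e$, with base triples $(s,u,t)$ and $(t,r,s)$ (regions listed in clockwise order); each has as regions all regions of $\mathcal G$ adjacent to it (the first does not include $r$, the second does not include $u$). A subtree of $\mathcal G$ means such a rooted tree. The label of the root edge in the tree with base triple $(s_0,u_0,t_0)$, directed away from the root, is $2u_0-s_0t_0$. Such a tree is strictly rising if all its labels are $>2$ and all its edges (including the root edge) are positively directed away from the root. It is leveling if $D=4$ and its base triple $(s_0,u_0,t_0)$ satisfies $2<s_0$, $2<t_0$, $2\le u_0<s_0t_0/2$, or else has the form $(2,t_0,t_0)$ or $(s_0,s_0,2)$ with $s_0,t_0>2$. Let $\rho(x)=\cosh^{-1}(x/2)$. In case (iii) the topograph is rational (resp. irrational) if $\rho(s)/\rho(t)$ is rational (resp. irrational) for every pair of adjacent regions $s,t$ with $s>2$, $t>2$. A tree or topograph has repeated numbers if the same label appears in two different regions of it. *)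

(* Defs.v *)
From HB Require Import structures.
From mathcomp Require Import all_boot all_order all_algebra.
From mathcomp Require Import all_classical all_reals all_analysis.

Set Implicit Arguments.
Unset Strict Implicit.
Unset Printing Implicit Defensive.

Import Order.TTheory GRing.Theory Num.Theory.
Local Open Scope ring_scope.

(* A 3-regular tree drawn in the plane, as a rotation system on its darts
   (directed edges): [drev d] is [d] reversed, and [nxt d] is the next dart in
   clockwise order among the three darts leaving the origin of [d].
   Arriving at a vertex along [d], the left turn is [nxt (drev d)] and the right
   turn is [nxt (nxt (drev d))].  The complementary region on the left of [d]
   is [lreg d]; its boundary is followed by turning left forever, in both
   directions.  The graph is a tree because it is connected and a non-empty
   sequence of turns (a walk without backtracking) never comes back to the dart
   it started from; in particular it is infinite. *)
Record plane_tree := PlaneTree {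
  dart : Type;
  region : Type;
  drev : dart -> dart;
  nxt : dart -> dart;
  lreg : dart -> region;
  dart_inhabited : inhabited dart;
  drevK : involutive drev;
  drev_neq : forall d, drev d <> d;
  nxt3 : forall d, nxt (nxt (nxt d)) = d;
  nxt_neq : forall d, nxt d <> d;
  tree_connected : forall d e, exists w : seq bool,
    e = foldl (fun x b => if b then drev x else nxt x) d w;
  tree_acyclic : forall d (w : seq bool),
    d = foldl (fun x b => if b then nxt (drev x) else nxt (nxt (drev x))) d w ->
    w = [::];
  lreg_surj : forall A, exists d, lreg d = A;
  lreg_eq : forall d e, lreg d = lreg e <->
    exists n, iter n (fun x => nxt (drev x)) d = e \/
              iter n (fun x => nxt (drev x)) e = d
}.

Section Tree.
Variable T : plane_tree.
Implicit Types (d e : dart T) (A : region T).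

Definition turnl d : dart T := nxt (drev d).
Definition turnr d : dart T := nxt (nxt (drev d)).

(* The two regions beside the edge of [d] are [lreg d] and [rreg d]; the regions
   at its two ends are [ahead d] and [behind d]. *)
Definition rreg d : region T := lreg (drev d).
Definition ahead d : region T := lreg (turnr d).
Definition behind d : region T := ahead (drev d).

(* The subtree in front of [d], rooted on the edge of [d]: the darts
   [e] with [away d e] are its edges, root edge included, directed away from the
   root.  The tree on the other side of the same edge is that of [drev d]. *)
Inductive away d : dart T -> Prop :=
| away_root : away d d
| away_left e : away d e -> away d (turnl e)
| away_right e : away d e -> away d (turnr e).

Definition subtree_region d A : Prop :=
  exists2 e, away d e & A = lreg e \/ A = rreg e.

Definition proper_colouring (c : region T -> 'I_3) : Prop :=
  forall d, c (lreg d) <> c (rreg d).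

End Tree.

Section Topograph.
Variables (R : realType) (T : plane_tree).
Implicit Types (f g : region T -> R) (d e : dart T).

Definition is_markov f : Prop :=
  forall d, f (ahead d) + f (behind d) = f (lreg d) * f (rreg d).

(* The discriminator, computed at the origin of [d]. *)
Definition discr f d : R :=
  let r := f (lreg d) in
  let s := f (lreg (nxt d)) in
  let t := f (lreg (nxt (nxt d))) in
  r ^+ 2 + s ^+ 2 + t ^+ 2 - r * s * t.

(* The label of the edge of [d], directed as [d]. *)
Definition elabel f d : R := f (ahead d) - f (behind d).

Definition vertex_well f d : Prop :=
  [/\ 0 < elabel f d, 0 < elabel f (nxt d) & 0 < elabel f (nxt (nxt d))].

Definition edge_well f d : Prop :=
  [/\ elabel f d = 0, 2 < f (lreg d) & 2 < f (rreg d)].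

Definition negative_vertex_well f d : Prop :=
  [/\ f (lreg d) <= -2, f (lreg (nxt d)) <= -2
    & f (lreg (nxt (nxt d))) <= -2].

Definition sign_variant f g : Prop :=
  exists (c : region T -> 'I_3) (i j : 'I_3),
    [/\ proper_colouring c, i <> j &
        forall A, g A = if (c A == i) || (c A == j) then - f A else f A].

Definition strictly_rising f d : Prop :=
  (forall A, subtree_region d A -> 2 < f A) /\
  (forall e, away d e -> 0 < elabel f e).

Definition leveling f d : Prop :=
  let s0 := f (lreg d) in let u0 := f (ahead d) in let t0 := f (rreg d) in
  (forall e, discr f e = 4) /\
  [\/ [/\ 2 < s0, 2 < t0, 2 <= u0 & u0 < s0 * t0 / 2],
      [/\ s0 = 2, u0 = t0 & 2 < t0]
    | [/\ t0 = 2, u0 = s0 & 2 < s0]].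

Definition cosh (a : R) : R := (expR a + expR (- a)) / 2.

(* The inverse of [cosh] on the nonnegative reals ([0] when [y < 1]). *)
Definition arcosh (y : R) : R := xget 0 [set a : R | 0 <= a /\ cosh a = y]%classic.

Definition rho (x : R) : R := arcosh (x / 2).

Definition rational_topograph f : Prop :=
  forall d, 2 < f (lreg d) -> 2 < f (rreg d) ->
    rational (rho (f (lreg d)) / rho (f (rreg d))).

Definition irrational_topograph f : Prop :=
  forall d, 2 < f (lreg d) -> 2 < f (rreg d) ->
    irrational (rho (f (lreg d)) / rho (f (rreg d))).

Inductive kind := Well | Constant | Leveling | NegativeWell.

Definition beside_two_region f d : Prop := f (lreg d) = 2 \/ f (rreg d) = 2.

Definition has_form (k : kind) f : Prop :=
  match k with
  | Well =>
      (forall A, 2 <= f A) /\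
      ((exists d, vertex_well f d) \/ (exists d, edge_well f d))
  | Constant => forall A, f A = 2
  | Leveling =>
      [/\ forall d, discr f d = 4,
          forall A B, f A = 2 -> f B = 2 -> A = B
        & forall d,
            (~ beside_two_region f d ->
               (strictly_rising f d /\ leveling f (drev d)) \/
               (strictly_rising f (drev d) /\ leveling f d)) /\
            (beside_two_region f d -> leveling f d /\ leveling f (drev d))]
  | NegativeWell => exists d, negative_vertex_well f d
  end.

Definition has_form_up_to_sign (k : kind) f : Prop :=
  has_form k f \/
  exists g, [/\ is_markov g, has_form k g & sign_variant g f].

End Topograph.

(* Main.v *)
Require Import Defs.
From mathcomp Require Import all_boot all_order all_algebra.
From mathcomp Require Import all_classical all_reals all_analysis.
From mathcomp Require Import ring lra zify.
Import Order.TTheory GRing.Theory Num.Theory.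
Local Open Scope ring_scope.
Set Implicit Arguments.
Unset Strict Implicit.
Unset Printing Implicit Defensive.

(** The product of the three labels at a vertex is either negative somewhere,
    and then a sign variant has a negative vertex well, or positive everywhere,
    and then a sign variant has all labels [>= 2].  In the latter case write
    [(u - r)^2 = (s^2 - 4)(t^2 - 4) + 4(D - 4)] for the square of an edge label.
    If there is no well one can descend forever; when [D <> 4] the labels drop by
    at least a fixed amount at each step, which is absurd.  So [D < 4] forces a
    well, [D > 4] is impossible, and [D = 4] gives the constant or leveling form.

    When [D = 4], writing labels as [2 cosh h] turns the Markov relation into
    [h u = h s + h t] on rising edges and [h u = |h s - h t|] on the others.
    If the [h]-values are commensurable, Euclid's algorithm reaches [h = 0],
    a 2-region, and in a rising tree with root values [p g] and [q g] the value
    [(p + q + p q) g] occurs both to the left and to the right.  If they are not,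
    any two regions lie in a common rising tree, where [h] is a nonnegative
    integer combination of the two independent root values, and these
    coordinates determine the region. *)

(** * Simple transitivity of walks on darts, and lifting of maps *)

Section Lift.
Variable T : plane_tree.

Definition turn (b : bool) (d : dart T) := if b then turnl d else turnr d.
Definition turns (d : dart T) (t : seq bool) := foldl (fun x b => turn b x) d t.

Lemma turns_acyclic (d : dart T) t : turns d t = d -> t = [::].
Proof. by move=> h; apply: (@tree_acyclic T d); rewrite -/(turns _ _). Qed.

(** By induction on length, peel off the first and the last turn. If they differ, the word between
    them again reverses a dart; if they agree, that word followed by the opposite turn closes up,
    against acyclicity. *)
Lemma drev_turns_neq t (d : dart T) : drev (turns d t) <> d.
Proof.
elim: {t}(size t) {-2}t (leqnn (size t)) d => [|n IH] [|c t] //= le_tn d;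
  try exact: drev_neq.
rewrite -/(turns _ _); case/lastP: t le_tn => [_|t c' le_tn].
  rewrite /turns /= => /(congr1 (@drev T)); rewrite drevK.
  case: c; rewrite /turn /= /turnl /turnr; first exact: nxt_neq.
  by move=> h; apply: (@nxt_neq T (drev d)); rewrite -{1}h nxt3.
move=> /(congr1 (@drev T)); rewrite drevK /turns foldl_rcons -/(turns _ _).
set e1 := turn c d => he.
have sz_t : (size t <= n)%N by move: le_tn; rewrite size_rcons; lia.
have : e1 = turn c d by [].
move: e1 he => e1 he e1E.
have [h|h] : drev (turns e1 t) = e1 \/ turns e1 (rcons t (~~ c)) = e1.
  rewrite /turns foldl_rcons -/(turns _ _); move: e1E he.
  case: c le_tn => _; case: c' => /=; rewrite /turnl /turnr => e1E he.
  - by right; rewrite he.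
  - by left; rewrite [RHS]e1E -he nxt3.
  - by left; rewrite [RHS]e1E -he nxt3.
  - by right; rewrite [RHS]e1E -he nxt3.
exact: IH h.
by move/turns_acyclic: h; case: (t).
Qed.

(** These words are the normal forms in the free product of [Z/2] and [Z/3]. Moving the outer
    letters to the other side turns a nontrivial word fixing a dart into a closed sequence of turns,
    a reversal or a fixed point of [nxt], all excluded. *)
Lemma turns_normal_form_fix a t b (d : dart T) : (a < 3)%N ->
  let e := turns (iter a (@nxt T) d) t in
  (if b then drev e else e) = d -> [/\ a = 0%N, t = [::] & b = false].
Proof.
move=> lt_a3 /=; set y := iter a _ d => h.
have acy t' : t' != [::] -> turns y t' = y -> False.
  by move=> + /turns_acyclic => /[swap] ->.
case: b h => h.
  case: a lt_a3 @y acy h => [|[|[|//]]] _ /= acy h.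
  - by case: (@drev_turns_neq t d).
  - by case: (acy (rcons t true)); [case: (t)|rewrite /turns foldl_rcons -/(turns _ _) /= /turnl h].
  - by case: (acy (rcons t false)); [case: (t)|rewrite /turns foldl_rcons -/(turns _ _) /= /turnr h].
case/lastP: t h => [|t c] /= h.
  case: a lt_a3 @y acy h => [|[|[|//]]] _ //= _ h; first by case: (nxt_neq h).
  by case: (@nxt_neq T d); rewrite -{1}h nxt3.
rewrite /turns foldl_rcons -/(turns _ _) in h.
case: a lt_a3 @y acy h => [|[|[|//]]] _ /= acy h.
- by case: (acy (rcons t c)); [case: (t)|rewrite /turns foldl_rcons].
- case: c h; rewrite /= /turnl /turnr => h.
    by case: (acy (rcons t false)); [case: (t)|rewrite /turns foldl_rcons -/(turns _ _) /= /turnr h].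
  by case: (@drev_turns_neq t (nxt d)); rewrite -{2}h nxt3.
- case: c h; rewrite /= /turnl /turnr => h.
    by case: (@drev_turns_neq t (nxt (nxt d))); rewrite -{2}h nxt3.
  by case: (acy (rcons t true)); [case: (t)|rewrite /turns foldl_rcons -/(turns _ _) /= /turnl -{2}h nxt3].
Qed.

Variables (X : Type) (r n : X -> X).
Hypotheses (rK : involutive r) (n3 : forall x, n (n (n x)) = x).

(** A dart and a point of [X] move together, so that the orbit of a pair is a candidate for the
    graph of a map from darts to [X]. *)
Let step (p : dart T * X) (b : bool) :=
  if b then (drev p.1, r p.2) else (nxt p.1, n p.2).
Let walk p w := foldl step p w.
Let pturns p (t : seq bool) :=
  foldl (fun q b => let q' := step (step q true) false in
                    if b then q' else step q' false) p t.

Lemma fst_pturns p t : (pturns p t).1 = turns p.1 t.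
Proof. by elim: t p => //= -[] t IH p; rewrite IH. Qed.

(** Letters are appended one at a time and reduced with the relations saying that reversal has order
    2 and rotation order 3, valid on both components. *)
Lemma walk_normal_form p w : exists a t b, (a < 3)%N /\
  walk p w = (let q := pturns (iter a (step^~ false) p) t in
              if b then step q true else q).
Proof.
have s2 q : step (step q true) true = q by case: q => d x; rewrite /step /= drevK rK.
have s3 q : step (step (step q false) false) false = q.
  by case: q => d x; rewrite /step /= nxt3 n3.
elim/last_ind: w => [|w c [a [t [b [lt_a3 IH]]]]]; first by exists 0%N, [::], false.
rewrite /walk foldl_rcons -/(walk _ _) IH; cbv zeta.
case: c; first by exists a, t, (~~ b); split => //; case: (b); rewrite ?s2.
case: b {IH}; first by exists a, (rcons t true), false; rewrite /pturns foldl_rcons.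
case/lastP: t => [|t c].
  case: a lt_a3 => [|[|[|//]]] _ /=.
  - by exists 1%N, [::], false.
  - by exists 2%N, [::], false.
  - by exists 0%N, [::], false; split => //; exact: s3.
case: c; rewrite /pturns foldl_rcons -/(pturns _ _).
  by exists a, (rcons t false), false; rewrite /pturns foldl_rcons.
by exists a, t, true; split => //; exact: s3.
Qed.

(** The dart component alone forces the normal form to be empty, so the point of [X] comes back
    too. *)
Lemma walk_loop p w : (walk p w).1 = p.1 -> walk p w = p.
Proof.
have [a [t [b [lt_a3 ->]]]] := walk_normal_form p w.
have fst_iter k : (iter k (step^~ false) p).1 = iter k (@nxt T) p.1.
  by elim: k => //= k ->.
move=> /= h; have [] := @turns_normal_form_fix a t b p.1 lt_a3.
  by rewrite -fst_iter -fst_pturns -h; case: (b).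
by move=> -> -> ->.
Qed.

Lemma walk_inv w : exists w', forall p, walk (walk p w) w' = p.
Proof.
elim: w => [|b w [w' IH]]; first by exists [::].
exists (w' ++ if b then [:: true] else [:: false; false]) => p.
rewrite /walk /= foldl_cat -/(walk _ _) -/(walk (walk _ _) _) IH.
by case: b; case: p => d x; rewrite /step /= ?drevK ?rK ?nxt3 ?n3.
Qed.

(* The group generated by [drev] and [nxt], the free product of [Z/2] and
   [Z/3], acts simply transitively on the darts. *)
Lemma tree_lift (d0 : dart T) (x0 : X) : exists phi : dart T -> X,
  [/\ phi d0 = x0, forall e, phi (drev e) = r (phi e)
    & forall e, phi (nxt e) = n (phi e)].
Proof.
have fst_walk p w :
  (walk p w).1 = foldl (fun x b => if b then drev x else nxt x) p.1 w.
  by elim: w p => //= -[] w IH p; rewrite /walk /= -/(walk _ _) IH.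
(* The value at a dart is read off an arbitrary word reaching it. The choice is harmless: undoing
   [w'] and then following [w] is a loop based at the end of [w']. *)
pose word e := sval (cid (tree_connected d0 e)).
have wordE e : (walk (d0, x0) (word e)).1 = e.
  by rewrite fst_walk; exact/esym/(svalP (cid (tree_connected d0 e))).
have uniq_walk w w' : (walk (d0, x0) w).1 = (walk (d0, x0) w').1 ->
    (walk (d0, x0) w).2 = (walk (d0, x0) w').2.
  move=> h; have [v vE] := walk_inv w'.
  rewrite -(@walk_loop (walk (d0, x0) w') (v ++ w)).
    by rewrite /walk foldl_cat -!/(walk _ _) vE.
  by rewrite /walk foldl_cat -!/(walk _ _) vE.
exists (fun e => (walk (d0, x0) (word e)).2); split=> [|e|e].
- by rewrite (uniq_walk _ [::]) // wordE.
- rewrite (uniq_walk _ (rcons (word e) true)) ?wordE //.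
    by rewrite /walk foldl_rcons.
  by rewrite /walk foldl_rcons -/(walk _ _) /= wordE.
- rewrite (uniq_walk _ (rcons (word e) false)) ?wordE //.
    by rewrite /walk foldl_rcons.
  by rewrite /walk foldl_rcons -/(walk _ _) /= wordE.
Qed.

End Lift.

(** * Regions, subtrees and proper colourings *)

Section Regions.
Variable T : plane_tree.
Implicit Types d e : dart T.

Lemma lreg_turnl d : lreg (turnl d) = lreg d.
Proof. by apply: esym; apply/(lreg_eq d); exists 1%N; left. Qed.

Lemma lreg_nxt d : lreg (nxt d) = rreg d.
Proof. by rewrite -{1}[d]drevK; exact: lreg_turnl. Qed.

Lemma behindE d : behind d = lreg (nxt (nxt d)).
Proof. by rewrite /behind /ahead /turnr drevK. Qed.

Lemma rreg_nxt d : rreg (nxt d) = behind d.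
Proof. by rewrite -lreg_nxt behindE. Qed.

Lemma behind_nxt d : behind (nxt d) = lreg d.
Proof. by rewrite behindE nxt3. Qed.

Lemma lreg_rev d : lreg (drev d) = rreg d. Proof. by []. Qed.
Lemma rreg_rev d : rreg (drev d) = lreg d. Proof. by rewrite /rreg drevK. Qed.
Lemma ahead_rev d : ahead (drev d) = behind d. Proof. by []. Qed.
Lemma behind_rev d : behind (drev d) = ahead d.
Proof. by rewrite /behind drevK. Qed.

Lemma rreg_turnl d : rreg (turnl d) = ahead d.
Proof. by rewrite rreg_nxt behind_rev. Qed.
Lemma behind_turnl d : behind (turnl d) = rreg d.
Proof. by rewrite behind_nxt. Qed.
Lemma lreg_turnr d : lreg (turnr d) = ahead d. Proof. by []. Qed.
Lemma rreg_turnr d : rreg (turnr d) = rreg d.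
Proof. by rewrite rreg_nxt behind_nxt. Qed.
Lemma behind_turnr d : behind (turnr d) = lreg d.
Proof. by rewrite behind_nxt lreg_turnl. Qed.

Definition regE := (lreg_turnl, rreg_turnl, behind_turnl, lreg_turnr,
  rreg_turnr, behind_turnr, lreg_rev, rreg_rev, ahead_rev, behind_rev,
  lreg_nxt, rreg_nxt, behind_nxt).

Lemma dart_connected_ind (P : dart T -> Prop) d :
  P d -> (forall e, P e -> P (drev e)) -> (forall e, P e -> P (nxt e)) ->
  forall e, P e.
Proof.
move=> Pd Prev Pnxt e; have [w ->] := tree_connected d e.
elim/last_ind: w => // w b IH; rewrite foldl_rcons.
by case: b; [exact: Prev|exact: Pnxt].
Qed.

Lemma away_trans d e e' : away d e -> away e e' -> away d e'.
Proof. by move=> de; elim=> // x _ dx; constructor. Qed.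

(** [nxt] sends [turnl x] to [turnr x], and [turnr x] to the reverse of [x]; rotation can leave the
    subtree only at its root. *)
Lemma away_nxt d e : away d e ->
  e = d \/ away d (nxt e) \/ away d (drev (nxt e)).
Proof.
case=> [|x dx|x dx]; first by left.
  by right; left; exact: away_right.
by right; right; rewrite /turnr nxt3 drevK.
Qed.

(** When rotation leaves one of the two subtrees at its root, it enters the other. *)
Lemma away_cover d e : exists2 d', d' = d \/ d' = drev d &
  away d' e \/ away d' (drev e).
Proof.
move: e; apply: (dart_connected_ind (d := d)) => [|e [d' dd' h]|e [d' dd' [h|h]]].
- by exists d; [left|left; exact: away_root].
- by exists d' => //; rewrite drevK; case: h; [right|left].
- have [->|h'] := away_nxt h; last by exists d'.
  exists (drev d'); last by left; rewrite -{2}[d']drevK; exact/away_left/away_root.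
  by case: dd' => ->; rewrite ?drevK; [right|left].
- exists d' => //; left; rewrite -[e]drevK; exact: away_left.
Qed.

Lemma away_cover_vertex d e :
  exists2 d', [\/ d' = d, d' = nxt d | d' = nxt (nxt d)] &
  away d' e \/ away d' (drev e).
Proof.
move: e; apply: (dart_connected_ind (d := d)) => [|e [d' dd' h]|e [d' dd' [h|h]]].
- by exists d; [constructor 1|left; exact: away_root].
- by exists d' => //; rewrite drevK; case: h; [right|left].
- have [->|h'] := away_nxt h; last by exists d'.
  exists (nxt d'); last by left; exact: away_root.
  by case: dd' => ->; rewrite ?nxt3; [constructor 2|constructor 3|constructor 1].
- exists d' => //; left; rewrite -[e]drevK; exact: away_left.
Qed.

(** Labellings of regions come from a state carried by the darts; the condition on [g] makes the
    label constant along the boundary of a region. *)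
Lemma region_lift (X Y : Type) (r n : X -> X) (g : X -> Y) (d0 : dart T) x0 :
  involutive r -> (forall x, n (n (n x)) = x) -> (forall x, g (n (r x)) = g x) ->
  exists (phi : dart T -> X) (F : region T -> Y),
  [/\ phi d0 = x0, forall e, phi (drev e) = r (phi e),
      forall e, phi (nxt e) = n (phi e) & forall e, F (lreg e) = g (phi e)].
Proof.
move=> rK n3 gnr; have [phi [phi0 phir phin]] := tree_lift rK n3 d0 x0.
pose F A := g (phi (sval (cid (lreg_surj A)))).
exists phi, F; split=> // e; rewrite /F; case: cid => e' /= /lreg_eq.
have iterE k x : g (phi (iter k (fun x => nxt (drev x)) x)) = g (phi x).
  by elim: k => //= k IH; rewrite phin phir gnr.
by case=> k [] <-; rewrite iterE.
Qed.

(** The state is the pair of colours on the left and on the right. Three distinct elements of [Z/3]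
    sum to zero, which gives the third colour at a vertex. *)
Lemma proper_colouring_exists : exists c : region T -> 'I_3, proper_colouring c.
Proof.
have [d0] := dart_inhabited T.
pose r (x : 'Z_3 * 'Z_3) := (x.2, x.1).
pose n (x : 'Z_3 * 'Z_3) := (x.2, - x.1 - x.2).
have rK : involutive r by case.
have n3 x : n (n (n x)) = x by case: x => a b; congr pair; rewrite /=; ring.
have gnr x : (n (r x)).1 = x.1 by [].
have [phi [F [phi0 phir phin FE]]] := region_lift d0 (0, 1) rK n3 gnr.
have phi_neq e : (phi e).1 != (phi e).2.
  move: e; apply: (dart_connected_ind (d := d0)) => [|e|e]; first by rewrite phi0.
    by rewrite phir /= eq_sym.
  rewrite phin /=; apply: contra => /eqP h; rewrite -subr_eq0.
  have -> : (phi e).1 - (phi e).2 = - (3%:R * (phi e).2).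
    have -> : (phi e).1 = - (phi e).2 - (phi e).2 by rewrite {1}h; ring.
    ring.
  by rewrite (_ : 3%:R = 0 :> 'Z_3) ?mul0r ?oppr0 //; exact/val_inj.
exists F => d; rewrite -lreg_nxt !FE phin /=; exact/eqP.
Qed.

Lemma lreg_neq_rreg d : lreg d <> rreg d.
Proof. by have [c c_proper] := proper_colouring_exists; move=> /(congr1 c)/c_proper. Qed.

End Regions.

(** * Markov labellings, edge labels and sign changes *)

Section Markov.
Variables (R : realType) (T : plane_tree).
Implicit Types (f g : region T -> R) (d e : dart T).

(** The state is the triple of labels left, right and behind; reversal replaces the last label [z]
    by [x y - z]. *)
Lemma markov_exists d0 (l r b : R) : exists2 f, is_markov f &
  [/\ f (lreg d0) = l, f (rreg d0) = r & f (behind d0) = b].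
Proof.
pose rv (x : R * R * R) := (x.1.2, x.1.1, x.1.1 * x.1.2 - x.2).
pose nx (x : R * R * R) := (x.1.2, x.2, x.1.1).
have rK : involutive rv by case=> [[x y] z]; rewrite /rv /=; congr (_, _); ring.
have n3 x : nx (nx (nx x)) = x by case: x => [[]].
have gnr x : (nx (rv x)).1.1 = x.1.1 by [].
have [phi [f [phi0 phir phin fE]]] := region_lift d0 (l, r, b) rK n3 gnr.
have fr e : f (rreg e) = (phi e).1.2 by rewrite -lreg_nxt fE phin.
have fb e : f (behind e) = (phi e).2 by rewrite behindE fE !phin.
exists f; last by rewrite fE fr fb phi0.
by move=> d; rewrite -behind_rev !fb fr fE phir /=; ring.
Qed.

Lemma aheadE f d : is_markov f ->
  f (ahead d) = f (lreg d) * f (rreg d) - f (behind d).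
Proof. by move=> /(_ d) <-; ring. Qed.

Lemma discrE f d : discr f d =
  f (lreg d) ^+ 2 + f (rreg d) ^+ 2 + f (behind d) ^+ 2
  - f (lreg d) * f (rreg d) * f (behind d).
Proof. by rewrite /discr lreg_nxt -behindE. Qed.

(** Reversing [d] exchanges [behind d] and [ahead d], whose labels are the two roots of
    [X^2 - l r X + l^2 + r^2 - D]. *)
Lemma discr_const f d e : is_markov f -> discr f d = discr f e.
Proof.
move=> fM; move: d; apply: (dart_connected_ind (d := e)) => // x <-; rewrite !discrE !regE.
  rewrite (aheadE _ fM); ring.
ring.
Qed.

(** The square of the difference of the two end labels is the discriminant of the quadratic of which
    they are the roots. *)
Lemma elabel_sqr f d : is_markov f ->
  elabel f d ^+ 2 =
  (f (lreg d) ^+ 2 - 4) * (f (rreg d) ^+ 2 - 4) + 4 * (discr f d - 4).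
Proof. by move=> fM; rewrite /elabel discrE (aheadE _ fM); ring. Qed.

Lemma elabel_rev f d : elabel f (drev d) = - elabel f d.
Proof. by rewrite /elabel !regE opprB. Qed.

Lemma elabelE f d : is_markov f ->
  elabel f d = 2 * f (ahead d) - f (lreg d) * f (rreg d).
Proof. by move=> fM; rewrite /elabel (aheadE _ fM); ring. Qed.

(** Exactly two of three distinct colours lie in [{i, j}]. *)
Lemma flip_xor (x y z i j : 'I_3) : x <> y -> y <> z -> z <> x -> i <> j ->
  ((z == i) || (z == j)) = ((x == i) || (x == j)) (+) ((y == i) || (y == j)).
Proof.
move=> /eqP + /eqP + /eqP + /eqP; rewrite -!val_eqE /=.
move: (ltn_ord x) (ltn_ord y) (ltn_ord z) (ltn_ord i) (ltn_ord j).
move: (val x) (val y) (val z) (val i) (val j) => {}x {}y {}z {}i {}j /=.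
case: x => [|[|[|//]]] _; case: y => [|[|[|//]]] _; case: z => [|[|[|//]]] _ //;
case: i => [|[|[|//]]] _; case: j => [|[|[|//]]] _ //.
Qed.

Definition flip (c : region T -> 'I_3) (i j : 'I_3) f A :=
  if (c A == i) || (c A == j) then - f A else f A.

Section Flip.
Variables (c : region T -> 'I_3) (i j : 'I_3).
Hypotheses (c_proper : proper_colouring c) (ij : i <> j).

Let s A : R := if (c A == i) || (c A == j) then -1 else 1.

Let flipE f A : flip c i j f A = s A * f A.
Proof. by rewrite /flip /s; case: ifP; rewrite ?mulN1r ?mul1r. Qed.

Let colours d : [/\ c (lreg d) <> c (rreg d), c (rreg d) <> c (behind d)
  & c (behind d) <> c (lreg d)].
Proof.
split; first exact: c_proper.
  by have := c_proper (d := nxt d); rewrite !regE.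
by have := c_proper (d := nxt (nxt d)); rewrite !regE.
Qed.

(** An even number of labels change sign at each vertex; this is why the Markov relation and the
    discriminator survive. *)
Let s_behind d : s (behind d) = s (lreg d) * s (rreg d).
Proof.
have [h1 h2 h3] := colours d; rewrite /s (flip_xor h1 h2 h3 ij).
by do 2 case: (_ || _); rewrite /= ?mulN1r ?mul1r ?opprK.
Qed.

Let s_sqr A : s A * s A = 1.
Proof. by rewrite /s; case: ifP; rewrite ?mulrNN ?mul1r. Qed.

Lemma flip_markov f : is_markov f -> is_markov (flip c i j f).
Proof.
move=> fM d; rewrite !flipE (aheadE _ fM) s_behind -(behind_rev d) s_behind !regE.
ring.
Qed.

Lemma flip_discr f d : discr (flip c i j f) d = discr f d.
Proof.
rewrite !discrE !flipE s_behind.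
have := s_sqr (lreg d); have := s_sqr (rreg d).
move: (s (lreg d)) (s (rreg d)) (f (lreg d)) (f (rreg d)) (f (behind d)).
move=> x y a b e hy hx.
transitivity ((x * x) * a ^+ 2 + (y * y) * b ^+ 2 + (x * x) * (y * y) * e ^+ 2
   - (x * x) * (y * y) * (a * b * e)); first by ring.
by rewrite hx hy; ring.
Qed.

Lemma flipK f A : flip c i j (flip c i j f) A = f A.
Proof. by rewrite !flipE mulrA s_sqr mul1r. Qed.

Lemma flip_norm f A : `|flip c i j f A| = `|f A|.
Proof. by rewrite /flip; case: ifP; rewrite ?normrN. Qed.

End Flip.

Lemma sign_variantE f g : sign_variant f g -> exists c i j,
  [/\ proper_colouring c, i <> j & g = flip c i j f].
Proof. by move=> [c [i [j [h1 h2 h3]]]]; exists c, i, j; split=> //; apply/funext. Qed.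

Lemma sign_variant_sym f g : sign_variant f g -> sign_variant g f.
Proof.
move=> /sign_variantE[c [i [j [cP ij ->]]]]; exists c, i, j; split=> // A.
by rewrite -/(flip c i j (flip c i j f) A) flipK.
Qed.

Lemma sign_variant_norm f g A : sign_variant f g -> `|g A| = `|f A|.
Proof. by move=> /sign_variantE[c [i [j [cP ij ->]]]]; rewrite flip_norm. Qed.

Lemma sign_variant_discr f g d : sign_variant f g -> discr g d = discr f d.
Proof. by move=> /sign_variantE[c [i [j [cP ij ->]]]]; rewrite flip_discr. Qed.

Lemma sign_variant_at f d : is_markov f -> exists g,
  [/\ is_markov g, sign_variant g f & [/\ g (lreg d) = - f (lreg d),
   g (rreg d) = - f (rreg d) & g (behind d) = f (behind d)]].
Proof.
move=> fM; have [c cP] := proper_colouring_exists T.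
have ij := cP d; exists (flip c (c (lreg d)) (c (rreg d)) f); split.
- exact: flip_markov.
- apply: sign_variant_sym; exists c, (c (lreg d)), (c (rreg d)); split=> // A.
- rewrite /flip !eqxx orbT /=; split=> //.
  have := cP (nxt d); have := cP (nxt (nxt d)); rewrite !regE.
  by move=> /eqP/negPf -> /eqP; rewrite eq_sym => /negPf ->.
Qed.

End Markov.

(** * Rising edges, negative wells, and descent to a well *)

Section Classification.
Variables (R : realType) (T : plane_tree).
Implicit Types (f g : region T -> R) (d e : dart T).

Definition rising f d := [/\ 2 < f (lreg d), 2 < f (rreg d) & 0 < elabel f d].

(** From [2a > l r] and [l > 2] follows [2 l a > l^2 r > 4r], and the label after a left turn is
    [l a - 2r]; right turns are symmetric. *)
Lemma rising_turn f d : is_markov f -> rising f d ->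
  rising f (turnl d) /\ rising f (turnr d).
Proof.
move=> fM [hl hr]; rewrite (elabelE _ fM) => ha.
rewrite /rising !(elabelE _ fM) !(aheadE (turnl d) fM) !(aheadE (turnr d) fM) !regE.
move: (f (lreg d)) (f (rreg d)) (f (ahead d)) hl hr ha => l r a hl hr ha.
have a2 : 2 < a by nra.
have hl2 : 0 < (l - 2) * (l + 2) * r by rewrite !mulr_gt0//; lra.
have hr2 : 0 < (r - 2) * (r + 2) * l by rewrite !mulr_gt0//; lra.
have h1 : 0 < l * (2 * a - l * r) by rewrite mulr_gt0//; lra.
have h2 : 0 < r * (2 * a - l * r) by rewrite mulr_gt0//; lra.
by split; split=> //; lra.
Qed.

Lemma rising_away f d e : is_markov f -> rising f d -> away d e -> rising f e.
Proof.
move=> fM hd; elim=> // x _ /(rising_turn fM) [] //.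
Qed.

Lemma rising_strictly f d : is_markov f -> rising f d -> strictly_rising f d.
Proof.
move=> fM hd; split=> [A [e de]|e de]; have [hl hr he] := rising_away fM hd de => //.
by case=> ->.
Qed.

Lemma elabel_turnl f d : is_markov f ->
  elabel f (turnl d) = f (lreg d) * f (ahead d) - 2 * f (rreg d).
Proof. by move=> fM; rewrite (elabelE _ fM) (aheadE _ fM) !regE; ring. Qed.

Lemma elabel_turnr f d : is_markov f ->
  elabel f (turnr d) = f (ahead d) * f (rreg d) - 2 * f (lreg d).
Proof. by move=> fM; rewrite (elabelE _ fM) (aheadE _ fM) !regE; ring. Qed.

Lemma elabel_nxt f d : is_markov f ->
  elabel f (nxt d) = f (rreg d) * f (behind d) - 2 * f (lreg d).
Proof. by move=> fM; rewrite (elabelE _ fM) (aheadE _ fM) !regE; ring. Qed.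

Lemma elabel_nxt2 f d : is_markov f ->
  elabel f (nxt (nxt d)) = f (behind d) * f (lreg d) - 2 * f (rreg d).
Proof. by move=> fM; rewrite (elabel_nxt _ fM) !regE. Qed.

Lemma elabel_behind f d : is_markov f ->
  elabel f d = f (lreg d) * f (rreg d) - 2 * f (behind d).
Proof. by move=> fM; rewrite (elabelE _ fM) (aheadE _ fM); ring. Qed.

Lemma negative_vertex_wellE f d : negative_vertex_well f d <->
  [/\ f (lreg d) <= -2, f (rreg d) <= -2 & f (behind d) <= -2].
Proof. by rewrite /negative_vertex_well -behindE lreg_nxt. Qed.

Lemma negative_vertex_well_nxt f d :
  negative_vertex_well f d -> negative_vertex_well f (nxt d).
Proof. by move=> /negative_vertex_wellE[? ? ?]; apply/negative_vertex_wellE; rewrite !regE. Qed.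

Lemma negative_vertex_well_discr f w d : is_markov f ->
  negative_vertex_well f w -> 20 <= discr f d.
Proof.
move=> fM /negative_vertex_wellE[]; rewrite (discr_const d w fM) discrE.
move: (f _) (f _) (f _) => x y z hx hy hz.
have h : 4 <= x * y by nra.
have : 8 <= x * y * - z by nra.
nra.
Qed.

(* Up to signs, the tree in front of [d] is a rising one. *)
Definition abs_rising f d :=
  [/\ 2 <= `|f (lreg d)|, 2 <= `|f (rreg d)|,
      0 < f (lreg d) * f (rreg d) * f (ahead d),
      `|f (lreg d)| < `|f (ahead d)| & `|f (rreg d)| < `|f (ahead d)| ].

(** The growth comes from [|l a - r| >= 2|a| - |r| > |a|]. *)
Lemma abs_rising_step (l r a : R) : 2 <= `|l| -> 0 < l * r * a ->
  `|l| < `|a| -> `|r| < `|a| ->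
  [/\ 0 < l * a * (l * a - r), `|l| < `|l * a - r| & `|a| < `|l * a - r|].
Proof.
move=> l2 lra_gt0 la ra.
have la2 : 2 * `|a| <= `|l * a| by rewrite normrM ler_wpM2r.
have haa : `|a| < `|l * a - r| by have := lerB_dist (l * a) r; lra.
split=> //; last exact: lt_trans haa.
have -> : l * a * (l * a - r) = `|l * a| ^+ 2 - `|l * r * a|.
  by rewrite real_normK ?num_real// gtr0_norm//; ring.
by rewrite [l * r * a]mulrAC (normrM (l * a)) expr2 -mulrBr mulr_gt0//; have := normr_ge0 r; lra.
Qed.

Lemma abs_rising_turn f d : is_markov f -> abs_rising f d ->
  abs_rising f (turnl d) /\ abs_rising f (turnr d).
Proof.
move=> fM [hl hr hlra la ra].
rewrite /abs_rising !(aheadE (turnl d) fM) !(aheadE (turnr d) fM) !regE.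
have [h1 h2 h3] := abs_rising_step hl hlra la ra.
have hrla : 0 < f (rreg d) * f (lreg d) * f (ahead d) by rewrite [_ * f (lreg d)]mulrC.
have [h4 h5 h6] := abs_rising_step hr hrla ra la.
rewrite [f (ahead d) * f (rreg d)]mulrC.
by split; split=> //; lra.
Qed.

(** Absolute values grow strictly along the three subtrees leaving the well, so every region first
    met beyond their roots exceeds 2 in absolute value. *)
Lemma negative_vertex_well_two f w A : is_markov f -> negative_vertex_well f w ->
  `|f A| = 2 -> [\/ A = lreg w, A = lreg (nxt w) | A = lreg (nxt (nxt w))].
Proof.
move=> fM wneg; pose W A := [\/ A = lreg w, A = lreg (nxt w) | A = lreg (nxt (nxt w))].
rewrite -/(W A).
suff H e : W (lreg e) \/ 2 < `|f (lreg e)|.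
  have [e <-] := lreg_surj A; case: (H e) => // + h2; rewrite h2 ltxx //.
have Wrot d' : [\/ d' = w, d' = nxt w | d' = nxt (nxt w)] ->
    negative_vertex_well f d' /\ [/\ W (lreg d') & W (rreg d')].
  have w1 := negative_vertex_well_nxt wneg; have w2 := negative_vertex_well_nxt w1.
  rewrite -lreg_nxt; case=> ->; rewrite ?nxt3 /W; split=> //; split;
    by [constructor 1|constructor 2|constructor 3].
have [d' /Wrot [/negative_vertex_wellE [hl hr hb] [Wl Wr]] de] := away_cover_vertex w e.
have base : abs_rising f d'.
  rewrite /abs_rising (aheadE _ fM).
  move: (f (lreg d')) (f (rreg d')) (f (behind d')) hl hr hb => l r b hl hr hb.
  have lr : 4 <= l * r by nra.
  have h1 : 0 <= (- 2 - l) * - r by rewrite mulr_ge0//; lra.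
  have h2 : 0 <= (- 2 - r) * - l by rewrite mulr_ge0//; lra.
  rewrite (@ler0_norm _ l) ?(@ler0_norm _ r) ?(@ger0_norm _ (l * r - b)); try lra.
  by split; [lra|lra|apply: mulr_gt0; lra|lra|lra].
have step x : away d' x -> [/\ abs_rising f x, W (lreg x) \/ 2 < `|f (lreg x)|
    & W (rreg x) \/ 2 < `|f (rreg x)|].
  elim=> [|y _ [hy yl yr]|y _ [hy yl yr]]; first by split=> //; left.
    have [h1 _] := abs_rising_turn fM hy; split=> //; rewrite !regE //.
    by right; case: hy => ? ? ? ? ?; lra.
  have [_ h1] := abs_rising_turn fM hy; split=> //; rewrite !regE //.
  by right; case: hy => ? ? ? ? ?; lra.
case: de => /step[_ h1 h2] //; by move: h2; rewrite regE.
Qed.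

(** The order on real labels is not well-founded, so a fixed drop [c] is required at each step; the
    Archimedean property then excludes endless descent. *)
Lemma descent (P : dart T -> Prop) (F : dart T -> R) (c : R) : 0 < c ->
  (forall d, P d -> 0 <= F d) ->
  (forall d, P d -> exists2 e, P e & F e <= F d - c) -> forall d, ~ P d.
Proof.
move=> c0 F0 step d Pd.
have H n : forall x, P x -> n%:R * c <= F x.
  elim: n => [|n IH] x Px; first by rewrite mul0r F0.
  have [y Py hy] := step x Px; have := IH y Py.
  rewrite -addn1 natrD mulrDl mul1r; lra.
have := archi_boundP (F0 d Pd : 0 <= F d).
have := archi_boundP (divr_ge0 (F0 d Pd) (ltW c0)).
by rewrite ltr_pdivrMr// ltNge H.
Qed.

(** As a function of [z] the left side decreases up to [x y / 2], so it is largest at [z = y]; there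
    it is [x^2 - (x - 2) y^2], at most [x^2 (3 - x)], and [4 - x^2 (3 - x) = (x - 2)^2 (x + 1)]. *)
Lemma vertex_ineq_sorted (x y z : R) : 2 <= x -> x <= y -> y <= z ->
  2 * z <= x * y -> x ^+ 2 + y ^+ 2 + z ^+ 2 - x * y * z <= 4.
Proof.
move=> x2 xy yz zxy.
have h1 : 0 <= (z - y) * (x * y - y - z) by rewrite mulr_ge0//; nra.
have h2 : 0 <= (x - 2) * ((y - x) * (y + x)) by rewrite !mulr_ge0//; lra.
have h3 : 0 <= (x - 2) ^+ 2 * (x + 1) by rewrite mulr_ge0 ?sqr_ge0//; lra.
by nra.
Qed.

Lemma vertex_ineq_sorted_strict (x y z : R) : 2 <= x -> x <= y -> y <= z ->
  2 * z < x * y -> x ^+ 2 + y ^+ 2 + z ^+ 2 - x * y * z < 4.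
Proof.
move=> x2 xy yz zxy.
have x2' : 2 < x by nra.
have h1 : 0 <= (z - y) * (x * y - y - z) by rewrite mulr_ge0//; nra.
have h2 : 0 <= (x - 2) * ((y - x) * (y + x)) by rewrite !mulr_ge0//; lra.
have h3 : 0 < (x - 2) ^+ 2 * (x + 1) by rewrite mulr_gt0 ?exprn_gt0//; lra.
by nra.
Qed.

(** The last three hypotheses say that no edge directed out of the vertex has a negative label. *)
Lemma vertex_ineq (x y z : R) : 2 <= x -> 2 <= y -> 2 <= z ->
  2 * z <= x * y -> 2 * x <= y * z -> 2 * y <= z * x ->
  x ^+ 2 + y ^+ 2 + z ^+ 2 - x * y * z <= 4.
Proof.
move=> x2 y2 z2 h1 h2 h3.
have [xy|/ltW yx] := leP x y; have [yz|/ltW zy] := leP y z;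
  have [xz|/ltW zx] := leP x z;
  [ have := @vertex_ineq_sorted x y z | have := @vertex_ineq_sorted x y z
  | have := @vertex_ineq_sorted x z y | have := @vertex_ineq_sorted z x y
  | have := @vertex_ineq_sorted y x z | have := @vertex_ineq_sorted y z x
  | have := @vertex_ineq_sorted z y x | have := @vertex_ineq_sorted z y x ];
  lra.
Qed.

Lemma vertex_ineq_strict (x y z : R) : 2 <= x -> 2 <= y -> 2 <= z ->
  2 * z < x * y -> 2 * x < y * z -> 2 * y < z * x ->
  x ^+ 2 + y ^+ 2 + z ^+ 2 - x * y * z < 4.
Proof.
move=> x2 y2 z2 h1 h2 h3.
have [xy|/ltW yx] := leP x y; have [yz|/ltW zy] := leP y z;
  have [xz|/ltW zx] := leP x z;
  [ have := @vertex_ineq_sorted_strict x y z | have := @vertex_ineq_sorted_strict x y z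
  | have := @vertex_ineq_sorted_strict x z y | have := @vertex_ineq_sorted_strict z x y
  | have := @vertex_ineq_sorted_strict y x z | have := @vertex_ineq_sorted_strict y z x
  | have := @vertex_ineq_sorted_strict z y x | have := @vertex_ineq_sorted_strict z y x ];
  lra.
Qed.

(** If [D > 4], [elabel_sqr] bounds every edge label away from 0. Crossing an edge of negative label
    then lowers the sum of the labels at a vertex by a fixed amount, and a vertex without such an
    edge satisfies [vertex_ineq]. *)
Lemma discr_le4 f d : is_markov f -> (forall A, 2 <= f A) -> discr f d <= 4.
Proof.
move=> fM f2; rewrite leNgt; apply/negP => D4.
pose F x := f (lreg x) + f (rreg x) + f (behind x).
have c0 : 0 < Num.sqrt (4 * (discr f d - 4)) by rewrite sqrtr_gt0; lra.
have fall x : elabel f x < 0 -> F (drev x) <= F x - Num.sqrt (4 * (discr f d - 4)).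
  move=> x0; suff : elabel f x <= - Num.sqrt (4 * (discr f d - 4)).
    by rewrite /F !regE /elabel; lra.
  rewrite lerNr -(@ler_pXn2r _ 2)// ?nnegrE ?sqrtr_ge0//; last by lra.
  rewrite sqr_sqrtr; last by lra.
  rewrite sqrrN (elabel_sqr _ fM) (discr_const x d fM) lerDr.
  by have := f2 (lreg x); have := f2 (rreg x) => r2 l2; apply: mulr_ge0; nra.
apply: (@descent (fun _ => True) F _ c0 _ _ d I) => [x _|x _].
  by rewrite /F; have := f2 (lreg x); have := f2 (rreg x); have := f2 (behind x); lra.
have [h|h1] := ltP (elabel f x) 0; first by exists (drev x) => //; exact: fall.
have [h|h2] := ltP (elabel f (nxt x)) 0.
  by exists (drev (nxt x)) => //; apply: (le_trans (fall _ h)); rewrite /F !regE; lra.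
have [h|h3] := ltP (elabel f (nxt (nxt x))) 0.
  by exists (drev (nxt (nxt x))) => //; apply: (le_trans (fall _ h)); rewrite /F !regE; lra.
rewrite (discr_const _ x fM) discrE in D4.
move: h1 h2 h3; rewrite (elabel_behind _ fM) (elabel_nxt _ fM) (elabel_nxt2 _ fM) => h1 h2 h3.
by have := @vertex_ineq (f (lreg x)) (f (rreg x)) (f (behind x)) (f2 _) (f2 _) (f2 _); lra.
Qed.

Lemma discr_lt4_neq2 f d A : is_markov f -> discr f d < 4 -> f A <> 2.
Proof.
move=> fM D4; have [e <-] := lreg_surj A => h.
have := sqr_ge0 (elabel f e); rewrite (elabel_sqr _ fM) h (discr_const e d fM).
rewrite (_ : 2 ^+ 2 - 4 = 0 :> R) ?mul0r ?add0r; first by lra.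
by ring.
Qed.

(** Without an edge well no edge label is 0. Walk along edges of negative label: the walk goes on
    unless its end is a vertex well, and the label behind decreases by a fixed amount. *)
Lemma discr_lt4_well f d : is_markov f -> (forall A, 2 <= f A) ->
  discr f d < 4 -> has_form Well f.
Proof.
move=> fM f2 D4; split=> //; apply: contrapT => /not_orP[noV noE].
have f2' A : 2 < f A.
  by rewrite lt_neqAle f2 andbT eq_sym; apply/eqP; exact: discr_lt4_neq2 D4.
have el0 x : elabel f x <> 0 by move=> h; apply: noE; exists x; split.
have [x0 x0neg] : exists x, elabel f x < 0.
  apply: contrapT => H; apply: noV; exists d.
  split; rewrite lt_neqAle eq_sym (introN eqP (@el0 _)) /= leNgt; apply/negP => h;
    by apply: H; eexists; exact: h.
pose M := f (lreg x0) + f (rreg x0) + f (behind x0).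
have M2 : 2 < M by rewrite /M; have := f2' (lreg x0); have := f2' (rreg x0);
  have := f2' (behind x0); lra.
pose k := 4 * (4 - discr f d); have k0 : 0 < k by rewrite /k; lra.
have N0 : 0 < (M + 2) * M ^+ 2 by rewrite mulr_gt0 ?exprn_gt0//; lra.
(* On labels bounded by [M], [(l^2-4)(r^2-4) >= 4(4-D)] keeps [l] away from [2]. *)
have away2 x : f (lreg x) <= M -> f (rreg x) <= M ->
    k / ((M + 2) * M ^+ 2) <= f (lreg x) - 2.
  move=> lM rM; rewrite ler_pdivrMr//.
  have := sqr_ge0 (elabel f x); rewrite (elabel_sqr _ fM) (discr_const x d fM).
  have := f2' (lreg x); have := f2' (rreg x); rewrite /k.
  move: (f (lreg x)) (f (rreg x)) lM rM => l r lM rM r2 l2 h.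
  have h1 : 0 <= (l - 2) * (M - l) * M ^+ 2 by rewrite !mulr_ge0 ?sqr_ge0//; lra.
  have h2 : 0 <= (l - 2) * (l + 2) * (M ^+ 2 - r ^+ 2 + 4).
    by rewrite !mulr_ge0//; [lra|lra|nra].
  nra.
pose P x := [/\ elabel f x < 0, f (lreg x) <= M, f (rreg x) <= M & f (behind x) <= M].
have eta0 : 0 < k / ((M + 2) * M ^+ 2) by rewrite divr_gt0.
apply: (@descent P (fun x => f (behind x)) _ eta0 _ _ x0).
- by move=> x _; have := f2 (behind x); lra.
- move=> x [xneg lM rM bM].
  have aM : f (ahead x) <= M by move: xneg; rewrite /elabel; lra.
  have hl := away2 x lM rM.
  have hr : k / ((M + 2) * M ^+ 2) <= f (rreg x) - 2.
    by rewrite -lreg_rev; apply: away2; rewrite !regE.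
  have := f2' (lreg x); have := f2' (rreg x) => r2 l2.
  (* The label behind becomes [r]. Since [b > l r / 2] and [r > 2], the drop [b - r] exceeds
     [l - 2], which is bounded below. *)
  have [h|h1] := ltP (elabel f (turnl x)) 0.
    exists (turnl x); first by split; rewrite ?regE.
    rewrite regE; move: xneg; rewrite (elabel_behind _ fM); nra.
  have [h|h2] := ltP (elabel f (turnr x)) 0.
    exists (turnr x); first by split; rewrite ?regE.
    rewrite regE; move: xneg; rewrite (elabel_behind _ fM); nra.
  case: noV; exists (drev x).
  have pos y : 0 <= elabel f y -> 0 < elabel f y.
    by move=> h; rewrite lt_neqAle h andbT eq_sym; apply/eqP.
  by split; [rewrite elabel_rev; lra|exact: pos|exact: pos].
- by split=> //; rewrite /M; have := f2' (lreg x0); have := f2' (rreg x0);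
    have := f2' (behind x0); lra.
Qed.

Lemma well_discr f d : is_markov f -> has_form Well f -> discr f d < 4.
Proof.
move=> fM [f2 [[x [h1 h2 h3]]|[x [h hl hr]]]]; rewrite (discr_const d x fM).
  move: h1 h2 h3; rewrite (elabel_behind _ fM) (elabel_nxt _ fM) (elabel_nxt2 _ fM) => h1 h2 h3.
  rewrite discrE.
  by have := @vertex_ineq_strict (f (lreg x)) (f (rreg x)) (f (behind x)) (f2 _) (f2 _) (f2 _); lra.
have := elabel_sqr x fM; rewrite h expr0n /=.
move: (f (lreg x)) (f (rreg x)) hl hr => l r l2 r2.
have : 0 < (l ^+ 2 - 4) * (r ^+ 2 - 4) by rewrite mulr_gt0//; nra.
by lra.
Qed.

End Classification.

(** * The case [D = 4], and existence and uniqueness of the form *)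

Section Leveling.
Variables (R : realType) (T : plane_tree).
Implicit Types (f g : region T -> R) (d e : dart T).

(** For [D = 4] the squared edge label is [(l^2 - 4)(r^2 - 4)], which vanishes beside a 2-region. *)
Lemma discr4_beside f d : is_markov f -> discr f d = 4 ->
  (f (lreg d) = 2 -> f (ahead d) = f (rreg d) /\ f (behind d) = f (rreg d)) /\
  (f (rreg d) = 2 -> f (ahead d) = f (lreg d) /\ f (behind d) = f (lreg d)).
Proof.
move=> fM D4; have := elabel_sqr d fM; rewrite D4 subrr mulr0 addr0.
rewrite /elabel (aheadE _ fM).
move: (f (lreg d)) (f (rreg d)) (f (behind d)) => l r b h.
split=> h2; rewrite h2 in h *.
  have /eqP : (2 * r - b - b) ^+ 2 = 0 by rewrite h; ring.
  by rewrite sqrf_eq0 => /eqP; split; lra.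
have /eqP : (l * 2 - b - b) ^+ 2 = 0 by rewrite h; ring.
by rewrite sqrf_eq0 => /eqP; split; lra.
Qed.

Lemma adjacent_two_constant f d : is_markov f -> discr f d = 4 ->
  f (lreg d) = 2 -> f (rreg d) = 2 -> has_form Constant f.
Proof.
move=> fM D4 hl hr A; have [e <-] := lreg_surj A.
suff : [/\ f (lreg e) = 2, f (rreg e) = 2 & f (behind e) = 2] by case.
have [/(_ hl) [_ hb] _] := discr4_beside fM D4.
move: e; apply: (dart_connected_ind (d := d)) => [|e [h1 h2 h3]|e [h1 h2 h3]].
- by rewrite hb.
- by rewrite !regE (aheadE _ fM) h1 h2 h3; split=> //; ring.
- by rewrite !regE.
Qed.

Section Discr4.
Variable f : region T -> R.
Hypotheses (fM : is_markov f) (D4 : forall d, discr f d = 4).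
Hypotheses (f2 : forall A, 2 <= f A).

Lemma ge2_gt2 A : f A <> 2 -> 2 < f A.
Proof. by move=> /eqP h; rewrite lt_neqAle eq_sym h f2. Qed.

Lemma rising_or_rev d : 2 < f (lreg d) -> 2 < f (rreg d) ->
  rising f d \/ rising f (drev d).
Proof.
move=> hl hr; have : elabel f d ^+ 2 > 0.
  by rewrite (elabel_sqr _ fM) D4 subrr mulr0 addr0 mulr_gt0//; nra.
rewrite exprn_even_gt0//= => h0; rewrite /rising !regE elabel_rev.
by have [h|h|h] := ltgtP (elabel f d) 0; [right|left|by rewrite h eqxx in h0];
  split=> //; lra.
Qed.

Lemma beside_two_rising d : f (lreg d) = 2 -> 2 < f (rreg d) ->
  rising f (turnr d).
Proof.
move=> hl hr; have [/(_ hl) [ha hb] _] := discr4_beside fM (D4 d).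
by rewrite /rising (elabel_turnr _ fM) !regE ha hl; split=> //; nra.
Qed.

Lemma beside_two_rising_r d : f (rreg d) = 2 -> 2 < f (lreg d) ->
  rising f (turnl d).
Proof.
move=> hr hl; have [_ /(_ hr) [ha hb]] := discr4_beside fM (D4 d).
by rewrite /rising (elabel_turnl _ fM) !regE ha hr; split=> //; nra.
Qed.

Hypothesis nonconstant : ~ has_form Constant f.

Lemma two_neighbour_gt2 d : f (lreg d) = 2 -> 2 < f (rreg d).
Proof.
move=> hl; apply: ge2_gt2 => hr; apply: nonconstant.
exact: adjacent_two_constant (D4 d) hl hr.
Qed.

Lemma two_region_unique A B : f A = 2 -> f B = 2 -> A = B.
Proof.
have [d <-] := lreg_surj A; have [e <-] := lreg_surj B => hd he.
(* Followed outwards, a dart either borders the given 2-region or is rising, and a rising dart has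
   no 2-region beside it. *)
pose Inv x := [\/ lreg x = lreg d, rreg x = lreg d | rising f x].
have step d' : Inv d' -> forall x, away d' x -> Inv x.
  move=> d'0 x; elim=> // y _ [h|h|h]; rewrite /Inv ?regE ?h.
  - by constructor 1.
  - constructor 3; apply: beside_two_rising_r; rewrite ?h//.
    by rewrite -[lreg y]rreg_rev; apply: two_neighbour_gt2; rewrite regE h.
  - by constructor 3; have [] := rising_turn fM h.
  - constructor 3; apply: beside_two_rising; rewrite ?h//.
    by apply: two_neighbour_gt2; rewrite h.
  - by constructor 2.
  - by constructor 3; have [] := rising_turn fM h.
suff : Inv e \/ Inv (drev e).
  have hr := two_neighbour_gt2 he; rewrite /Inv /rising !regE.
  case=> -[h|h|[h1 h2 _]] //.
  - by rewrite h hd ltxx in hr.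
  - by rewrite he ltxx in h1.
  - by rewrite h hd ltxx in hr.
  - by rewrite he ltxx in h2.
have [d' dd' de] := away_cover d e.
have Id' : Inv d' by case: dd' => ->; [constructor 1|constructor 2; rewrite regE].
by case: de => /(step _ Id'); [left|right].
Qed.

Lemma leveling_beside_two d : beside_two_region f d -> leveling f d.
Proof.
move=> h; split=> //; have [h1 h2] := discr4_beside fM (D4 d); case: h => h.
  by have [-> _] := h1 h; constructor 2; split=> //; exact: two_neighbour_gt2.
have [-> _] := h2 h; constructor 3; split=> //.
by rewrite -rreg_rev; apply: two_neighbour_gt2; rewrite regE.
Qed.

Lemma rising_rev_leveling d : rising f d -> leveling f (drev d).
Proof.
move=> [hl hr]; rewrite (elabel_behind _ fM) => h; split=> //; constructor 1.
by rewrite !regE; split=> //; rewrite 1?mulrC; lra.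
Qed.

Lemma discr4_leveling : has_form Leveling f.
Proof.
split=> //; first exact: two_region_unique.
move=> d; split=> [|h].
  move=> /not_orP[/ge2_gt2 hl /ge2_gt2 hr].
  have [h|h] := rising_or_rev hl hr; [left|right]; split.
  - exact: rising_strictly.
  - exact: rising_rev_leveling.
  - exact: rising_strictly.
  - by rewrite -[d]drevK; exact: rising_rev_leveling.
by split; apply: leveling_beside_two => //; case: h => h; [right|left]; rewrite regE.
Qed.

End Discr4.

Lemma leveling_ge2 f : has_form Leveling f -> forall A, 2 <= f A.
Proof.
move=> [_ _ H] A; have [d <-] := lreg_surj A; have [H1 H2] := H d.
have lev e : leveling f e -> 2 <= f (lreg e) /\ 2 <= f (rreg e).
  by case=> _ [[]|[]|[]] => *; split; lra.
have [h|h] := pselect (beside_two_region f d).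
  by have [/lev[]] := H2 h.
have [[_ /lev[]]|[_ /lev[]]] := H1 h => //.
by rewrite !regE.
Qed.

Lemma leveling_nonconstant f : has_form Leveling f -> ~ has_form Constant f.
Proof.
move=> [_ uniq2 _] /= fC; have [d] := dart_inhabited T.
by apply: (@lreg_neq_rreg T d); apply: uniq2; rewrite fC.
Qed.

Lemma ge2_form f : is_markov f -> (forall A, 2 <= f A) ->
  exists k, has_form k f.
Proof.
move=> fM f2; have [d] := dart_inhabited T.
have [D4|D4|D4] := ltgtP (discr f d) 4.
- by exists Well; exact: discr_lt4_well D4.
- by have := discr_le4 d fM f2; rewrite leNgt D4.
- have D4' e : discr f e = 4 by rewrite (discr_const e d fM).
  have [h|h] := pselect (has_form Constant f); first by exists Constant.
  by exists Leveling; exact: discr4_leveling.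
Qed.

Lemma form_exists f : is_markov f -> (forall A, f A <= -2 \/ 2 <= f A) ->
  exists k, has_form_up_to_sign k f.
Proof.
move=> fM f_range.
pose pr d := f (lreg d) * f (rreg d) * f (behind d).
pose ext g := [/\ is_markov g, forall A, `|g A| = `|f A|,
  forall d, g (lreg d) * g (rreg d) * g (behind d) = pr d & (g = f \/ sign_variant g f)].
have f_norm A : 2 <= `|f A|.
  by rewrite ler_normr; case: (f_range A) => h; apply/orP; [right|left]; lra.
have range g A : ext g -> 0 < g A -> 2 <= g A.
  by move=> [_ /(_ A) + _ _] => + g0; rewrite (gtr0_norm g0) => ->.
have range' g A : ext g -> g A < 0 -> g A <= -2.
  move=> [_ /(_ A) + _ _] => + g0; rewrite (ltr0_norm g0) => h.
  by have := f_norm A; rewrite -h; lra.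
have extf : ext f by split=> //; left.
have ext_flip d : exists2 g, ext g & [/\ g (lreg d) = - f (lreg d),
   g (rreg d) = - f (rreg d) & g (behind d) = f (behind d)].
  have [g [gM gv gE]] := sign_variant_at d fM; exists g => //; split=> //.
  - by move=> A; rewrite (sign_variant_norm _ gv).
  (* Equal discriminators and equal squares of labels force equal products. *)
  - move=> e; rewrite /pr; have := sign_variant_discr e gv.
    rewrite !discrE -(real_normK (num_real (g (lreg e)))).
    rewrite -(real_normK (num_real (g (rreg e)))) -(real_normK (num_real (g (behind e)))).
    rewrite -!(sign_variant_norm _ gv) !real_normK ?num_real //; lra.
  - by right.
have form k g : ext g -> has_form k g -> has_form_up_to_sign k f.
  by move=> [gM _ _ [<-|gv]] gk; [left|right; exists g].
have nz A : f A != 0 by apply/eqP => h; case: (f_range A); rewrite h; lra.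
have prN0 d : pr d != 0 by rewrite /pr !mulf_neq0.
have prnxt d : pr (nxt d) = pr d by rewrite /pr !regE; ring.
(* The three labels at a vertex can be given any signs with the same product. *)
have signs d s : (s = 1 \/ s = -1) -> 0 < s * pr d ->
    exists2 g, ext g & [/\ 0 < s * g (lreg d), 0 < s * g (rreg d) & 0 < s * g (behind d)].
  move=> hs; have ss : s * s = 1 by case: hs => ->; ring.
  have sE x : s * - x = - (s * x) by ring.
  rewrite /pr => hpr; have {hpr} : 0 < (s * f (lreg d)) * (s * f (rreg d)) * (s * f (behind d)).
    rewrite (_ : _ * _ = (s * s) * (s * (f (lreg d) * f (rreg d) * f (behind d)))); last by ring.
    by rewrite ss mul1r.
  have sN0 : s != 0 by case: hs => ->; rewrite ?oppr_eq0 oner_neq0.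
  have Hn A : s * f A < 0 \/ 0 < s * f A.
    by have [||/eqP] := ltgtP (s * f A) 0; [left|right|rewrite mulf_eq0 (negPf sN0) (negPf (nz A))].
  case: (Hn (lreg d)) => hl; case: (Hn (rreg d)) => hr; case: (Hn (behind d)) => hb hpr;
    move: hpr; rewrite -mulrA; first [rewrite (nmulr_rgt0 _ hl)|rewrite (pmulr_rgt0 _ hl)];
    first [rewrite (nmulr_rlt0 _ hr)|rewrite (pmulr_rlt0 _ hr)
          |rewrite (nmulr_rgt0 _ hr)|rewrite (pmulr_rgt0 _ hr)] => hpr; try lra.
  - have [g gx [gl gr gb]] := ext_flip d; exists g => //; rewrite gl gr gb !sE; split; lra.
  - have [g gx] := ext_flip (nxt (nxt d)); rewrite !regE => -[gb gl gr].
    by exists g => //; rewrite gl gr gb !sE; split; lra.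
  - have [g gx] := ext_flip (nxt d); rewrite !regE => -[gr gb gl].
    by exists g => //; rewrite gl gr gb !sE; split; lra.
  - by exists f.
have [[d hd]|Hpos] := pselect (exists d, pr d < 0).
  have [g gx [hl hr hb]] : exists2 g, ext g & [/\ 0 < -1 * g (lreg d),
      0 < -1 * g (rreg d) & 0 < -1 * g (behind d)].
    by apply: signs; [right|lra].
  exists NegativeWell; apply: (form _ g gx); exists d; apply/negative_vertex_wellE.
  by split; apply: (range' g) => //; lra.
have pr0 d : 0 < pr d.
  rewrite lt_neqAle eq_sym prN0 leNgt; apply/negP => h; apply: Hpos; by exists d.
have [d0] := dart_inhabited T.
have [g gx [hl hr hb]] : exists2 g, ext g & [/\ 0 < 1 * g (lreg d0),
    0 < 1 * g (rreg d0) & 0 < 1 * g (behind d0)].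
  by apply: signs; [left|have := pr0 d0; lra].
have [gM _ gpr _] := gx.
(* Crossing an edge keeps its two side labels, and the positive product fixes the sign of the
   third. *)
have gpos e : [/\ 0 < g (lreg e), 0 < g (rreg e) & 0 < g (behind e)].
  move: e; apply: (dart_connected_ind (d := d0)) => [|e [h1 h2 h3]|e [h1 h2 h3]].
  - by split; lra.
  - have := pr0 (drev e); rewrite -gpr !regE => h; split=> //.
    by move: h; rewrite !pmulr_rgt0 // mulr_gt0.
  - by rewrite !regE.
have [k gk] : exists k, has_form k g.
  apply: ge2_form => // A; have [e <-] := lreg_surj A.
  by apply: range => //; have [] := gpos e.
by exists k; exact: form gk.
Qed.

(** Both parameters are unchanged by sign variants, and the four conditions exclude one another. *)
Definition form_invariant (D : R) (allTwo : Prop) (k : kind) : Prop :=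
  match k with
  | Well => D < 4
  | Constant => D = 4 /\ allTwo
  | Leveling => D = 4 /\ ~ allTwo
  | NegativeWell => 20 <= D
  end.

Lemma has_form_invariant f k d : is_markov f -> has_form k f ->
  form_invariant (discr f d) (forall A, `|f A| = 2) k.
Proof.
move=> fM; case: k.
- exact: well_discr.
- move=> /= fC; rewrite discrE !fC; split; first by ring.
  by move=> A; rewrite fC ger0_norm.
- move=> fL; have [D4 _ _] := fL; split=> // H; apply: (leveling_nonconstant fL) => A.
  by rewrite -(H A) ger0_norm //; have := leveling_ge2 fL A; lra.
- by move=> /= [w]; exact: negative_vertex_well_discr.
Qed.

Lemma form_unique f k k' : is_markov f ->
  has_form_up_to_sign k f -> has_form_up_to_sign k' f -> k = k'.
Proof.
move=> fM; have [d] := dart_inhabited T.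
have H j : has_form_up_to_sign j f ->
    form_invariant (discr f d) (forall A, `|f A| = 2) j.
  case=> [|[g [gM gj gv]]]; first exact: has_form_invariant.
  have := has_form_invariant d gM gj; rewrite -(sign_variant_discr d gv).
  suff -> : (forall A, `|g A| = 2) = (forall A, `|f A| = 2).
    by [].
  by rewrite propeqE; split=> h A; rewrite -(h A) (sign_variant_norm _ gv).
move: (discr f d) (forall A, `|f A| = 2) H => D Q H /H + /H.
case: k; case: k' => //= h h'; exfalso;
  first [lra | by case: h => ? ?; lra | by case: h' => ? ?; lra
        | by case: h => _ h; case: h' => _ h'; auto].
Qed.

End Leveling.

(** * Hyperbolic cosine and its inverse *)

Section HyperbolicCosine.
Variable R : realType.
Implicit Types a b x y : R.

Definition cosh2 a : R := expR a + expR (- a).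

Lemma cosh2_opp a : cosh2 (- a) = cosh2 a.
Proof. by rewrite /cosh2 opprK addrC. Qed.

Lemma cosh20 : cosh2 0 = 2.
Proof. by rewrite /cosh2 oppr0 expR0. Qed.

Lemma cosh2_norm a : cosh2 `|a| = cosh2 a.
Proof. by have [h|h] := ger0P a; rewrite ?cosh2_opp. Qed.

Lemma cosh2M a b : cosh2 a * cosh2 b = cosh2 (a + b) + cosh2 (a - b).
Proof. by rewrite /cosh2 !opprD opprK !expRD; ring. Qed.

(** With [cosh2M], this gives [cosh2 (a + b)] and [cosh2 (a - b)] the sum and product of the end
    labels of an edge with sides [cosh2 a] and [cosh2 b] when [D = 4]. *)
Lemma cosh2_conj a b :
  cosh2 (a + b) * cosh2 (a - b) = cosh2 a ^+ 2 + cosh2 b ^+ 2 - 4.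
Proof.
have sqr c : cosh2 c ^+ 2 = cosh2 (c + c) + 2 by rewrite expr2 cosh2M subrr cosh20.
rewrite !sqr cosh2M (_ : a + b + (a - b) = a + a); last by ring.
by rewrite (_ : a + b - (a - b) = b + b); ring.
Qed.

Lemma cosh2_sub_le a b : 0 <= a -> 0 <= b -> cosh2 (a - b) <= cosh2 (a + b).
Proof.
move=> a0 b0; rewrite -subr_ge0.
have -> : cosh2 (a + b) - cosh2 (a - b) = (expR a - expR (- a)) * (expR b - expR (- b)).
  by rewrite /cosh2 !opprD opprK !expRD; ring.
by apply: mulr_ge0; rewrite subr_ge0 ler_expR; lra.
Qed.

Lemma cosh2_inj a b : 0 <= a -> 0 <= b -> cosh2 a = cosh2 b -> a = b.
Proof.
(* The product factors [cosh2 a - cosh2 b]; its second factor vanishes only for [a + b = 0], that is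
   [a = b = 0]. *)
move=> a0 b0 h; have /eqP : (expR a - expR b) * (1 - expR (- (a + b))) = 0.
  have aN : expR a * expR (- a) = 1 by rewrite -expRD subrr expR0.
  have bN : expR b * expR (- b) = 1 by rewrite -expRD subrr expR0.
  rewrite opprD expRD -[RHS](subrr (cosh2 b)) -{1}h /cosh2.
  transitivity (expR a - expR b - (expR a * expR (- a)) * expR (- b)
    + (expR b * expR (- b)) * expR (- a)); first by ring.
  by rewrite aN bN; ring.
rewrite mulf_eq0 => /orP[|]; rewrite subr_eq0 => /eqP.
  exact: expR_inj.
rewrite -{1}expR0 => /expR_inj; lra.
Qed.

Lemma cosh2_surj x : 2 <= x -> exists2 a, 0 <= a & cosh2 a = x.
Proof.
move=> x2; pose s := Num.sqrt (x ^+ 2 - 4).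
have s2 : s ^+ 2 = x ^+ 2 - 4 by rewrite sqr_sqrtr//; nra.
have s0 : 0 <= s := sqrtr_ge0 _.
have y1 : 1 <= (x + s) / 2 by lra.
(* The argument of [ln] is the larger root of [u + 1/u = x]. *)
exists (ln ((x + s) / 2)); first exact: ln_ge0.
have y0 : 0 < (x + s) / 2 by lra.
rewrite /cosh2 expRN lnK ?posrE//.
have yN0 := lt0r_neq0 y0.
rewrite (_ : ((x + s) / 2)^-1 = (x - s) / 2); first by field.
apply: (mulfI yN0); rewrite mulfV //.
transitivity ((x ^+ 2 - s ^+ 2) / 4); last by field.
by rewrite s2; field.
Qed.

(** The set defining [arcosh] is inhabited here, so [xget] returns one of its elements and not its
    default. *)
Lemma rho_spec x : 2 <= x -> 0 <= rho x /\ cosh2 (rho x) = x.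
Proof.
move=> /cosh2_surj[a a0 ax]; rewrite /rho /arcosh.
have : exists b : R, 0 <= b /\ Defs.cosh b = x / 2 by exists a; rewrite -ax.
move=> /(@xgetPex _ 0)[h1 h2]; split=> //.
by have := congr1 ( *%R^~ 2) h2; rewrite /Defs.cosh !divfK.
Qed.

Lemma rho_cosh2 a : rho (cosh2 a) = `|a|.
Proof.
have h2 : 2 <= cosh2 a.
  rewrite /cosh2; have := expR_gt0 a; have := expR_gt0 (- a).
  have : expR a * expR (- a) = 1 by rewrite -expRD subrr expR0.
  move: (expR _) (expR _) => u v uv u0 v0.
  by have := sqr_ge0 (u - v); nra.
have [h0 h] := rho_spec h2; apply: cosh2_inj => //.
by rewrite cosh2_norm.
Qed.

End HyperbolicCosine.

(** * Integer linear relations between two reals *)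

Section Commensurability.
Variable R : realType.
Implicit Types x y : R.

(** Unlike a ratio, an integer relation stays meaningful when a value is 0, as happens at a
    2-region. *)
Definition commensurable x y := exists p q : int,
  (p != 0) || (q != 0) /\ p%:~R * x + q%:~R * y = 0.

Lemma commensurable_sym x y : commensurable x y -> commensurable y x.
Proof. by move=> [p [q [pq h]]]; exists q, p; rewrite orbC addrC. Qed.

Lemma commensurable_add x y : commensurable x y -> commensurable y (x + y).
Proof.
move=> [p [q [pq h]]]; exists (q - p), p; split.
  by case: (eqVneq p 0) pq => [-> /= q0|p0 _]; rewrite ?subr0 ?q0 ?orbT.
by rewrite -h rmorphB /=; ring.
Qed.

Lemma commensurable_opp x y : commensurable x y -> commensurable x (- y).
Proof.
move=> [p [q [pq h]]]; exists p, (- q); rewrite oppr_eq0; split=> //.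
by rewrite -h rmorphN /=; ring.
Qed.

Lemma commensurable_rational x y : 0 < x -> 0 < y ->
  commensurable x y <-> rational (x / y).
Proof.
move=> x0 y0; split=> [[p [q [pq h]]]|/rationalP[a [b hab]]].
  have p0 : p != 0.
    apply/negP => /eqP p0; move: pq h; rewrite p0 eqxx /= mul0r add0r => q0 /eqP.
    by rewrite mulf_eq0 intr_eq0 (negPf q0) gt_eqF.
  have pR : p%:~R != 0 :> R by rewrite intr_eq0.
  exists (- q%:~R / p%:~R) => //; rewrite fmorph_div rmorphN /= !ratr_int.
  have yN0 := lt0r_neq0 y0.
  apply: (mulfI pR); apply: (mulIf yN0).
  rewrite mulrCA mulrV ?unitfE// mulr1 mulrA divfK//; lra.
have b0 : b != 0%N.
  apply/negP => /eqP b0; move: hab; rewrite b0 invr0 mulr0 => h.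
  by have := divr_gt0 x0 y0; rewrite h ltxx.
exists b%:Z, (- a); split; first by rewrite eqz_nat b0.
have bR : b%:R != 0 :> R by rewrite pnatr_eq0.
have -> : x = a%:~R / b%:R * y by rewrite -hab divfK// gt_eqF.
by rewrite rmorphN /= -pmulrn; field.
Qed.

Lemma incommensurable_inj x y (m n m' n' : nat) : ~ commensurable x y ->
  m%:R * x + n%:R * y = m'%:R * x + n'%:R * y -> m = m' /\ n = n'.
Proof.
move=> xy h; apply: contrapT => mn; apply: xy.
exists (m%:Z - m'%:Z), (n%:Z - n'%:Z); split; last first.
  by rewrite !rmorphB /= -!pmulrn; lra.
rewrite !subr_eq0 !eqz_nat -negb_and; apply/negP => /andP[/eqP ? /eqP ?].
exact: mn.
Qed.

End Commensurability.

(* The topograph with a 2-region surrounded by 3-regions tells them apart. *)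
Lemma fan_regions_neq (R : realType) (T : plane_tree) (d : dart T) p q :
  lreg (iter p.+2 (@turnr T) d) <> rreg (iter q (@turnl T) d).
Proof.
have [f fM [hl hr hb]] := @markov_exists R T d 2 3 3.
have left : [/\ f (lreg (iter q (@turnl T) d)) = 2,
    f (rreg (iter q (@turnl T) d)) = 3 & f (behind (iter q (@turnl T) d)) = 3].
  by elim: q => //= q [h1 h2 h3]; rewrite !regE (aheadE _ fM) h1 h2 h3; split=> //; ring.
(* Two right turns are needed: after one, the left region is [ahead d], which is also on the right
   of [turnl d]. From the second on, its label exceeds 3. *)
have right : rising f (iter p.+1 (@turnr T) d) /\
    f (rreg (iter p.+1 (@turnr T) d)) = 3.
  elim: p => [|p [h1 h2]] /=.
    by rewrite /rising (elabel_turnr _ fM) !regE (aheadE _ fM) hl hr hb; split; [split|]; lra.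
  by split; [have [] := rising_turn fM h1|rewrite rreg_turnr].
have [[h1 h2 h3] h4] := right; have [_ h5 _] := left.
move=> /= /(congr1 f); rewrite h5 lreg_turnr.
by move: h3 => /=; rewrite (elabelE _ fM) h4; nra.
Qed.

(** * Integer coordinates of regions in a rising tree *)

Section AdditiveLabelling.
Variables (R : realType) (T : plane_tree) (f h : region T -> R).
Implicit Types (d e : dart T) (A B : region T).
Hypothesis fM : is_markov f.
Hypothesis h_add : forall d, rising f d ->
  h (ahead d) = h (lreg d) + h (rreg d).

Definition side d t A := A = lreg (turns d t) \/ A = rreg (turns d t).

Lemma away_turns d e : away d e -> exists t, e = turns d t.
Proof.
elim=> [|x _ [t ->]|x _ [t ->]]; first by exists [::].
  by exists (rcons t true); rewrite /turns foldl_rcons.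
by exists (rcons t false); rewrite /turns foldl_rcons.
Qed.

(** A left turn makes the root values [h l] and [h l + h r], so coordinates [(m, n)] there become
    [(m + n, n)]; right turns are symmetric. Only the two root regions have a zero coordinate. *)
Lemma side_coord d t A : rising f d -> side d t A ->
  exists m n : nat, h A = m%:R * h (lreg d) + n%:R * h (rreg d) /\
  [\/ [/\ m = 1%N, n = 0%N & A = lreg d], [/\ m = 0%N, n = 1%N & A = rreg d]
    | (0 < m)%N /\ (0 < n)%N].
Proof.
rewrite /side; elim: t d => [|c t IH] d hd.
  case=> ->; [exists 1%N, 0%N|exists 0%N, 1%N]; split; try by rewrite /=; ring.
    by constructor 1.
  by constructor 2.
have [hdl hdr] := rising_turn fM hd; have ha := h_add hd.
case: c => hs; [have := IH _ hdl hs|have := IH _ hdr hs]; rewrite !regE ha.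
  case=> [m [n [hA hmn]]]; exists (m + n)%N, n; split; first by rewrite hA natrD; ring.
  by case: hmn => [[-> -> ->]|[-> -> _]|[m0 n0]]; [constructor 1|constructor 3|constructor 3; lia].
case=> [m [n [hA hmn]]]; exists m, (m + n)%N; split; first by rewrite hA natrD; ring.
by case: hmn => [[-> -> _]|[-> -> ->]|[m0 n0]]; [constructor 3|constructor 2|constructor 3; lia].
Qed.

Hypothesis h_incomm : forall d, ~ commensurable (h (lreg d)) (h (rreg d)).

(** Coordinates satisfy [m >= n] after a left turn and [m <= n] after a right one, so they determine
    the path, as in the Stern-Brocot tree. *)
Lemma side_inj d t t' A B : rising f d -> side d t A -> side d t' B ->
  h A = h B -> A = B.
Proof.
have nil d' t2 C D : rising f d' -> side d' [::] C -> side d' t2 D -> h C = h D -> C = D.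
  move=> hd hC /(side_coord hd)[m [n [hD cD]]] hCD.
  have inj m' n' hC' := incommensurable_inj (m := m') (n := n') (@h_incomm d')
    (etrans (esym hC') (etrans hCD hD)).
  case: hC inj => -> inj.
    have [|m1 n0] := inj 1%N 0%N; first by rewrite /=; ring.
    by case: cD => [[_ _ ->]|[m0 _ _]|[_ +]] //; move: m1 n0; [rewrite m0|move=> _ <-].
  have [|m0 n1] := inj 0%N 1%N; first by rewrite /=; ring.
  by case: cD => [[m1 _ _]|[_ _ ->]|[+ _]] //; move: m0 n1; [rewrite m1|move=> <- _].
(* After opposite turns, equal coordinates force [m = n' = 0], and both regions are the shared one
   [ahead d']. *)
have mixed d' t1 t2 C D : rising f d' -> side (turnl d') t1 C -> side (turnr d') t2 D ->
    h C = h D -> C = D.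
  move=> hd; have [hdl hdr] := rising_turn fM hd; have ha := h_add hd.
  move=> /(side_coord hdl)[m [n [+ +]]] /(side_coord hdr)[m' [n' [+ +]]].
  rewrite !regE ha => hC cC hD cD hCD.
  have [e1 e2] : (m + n = m')%N /\ n = (m' + n')%N.
    apply: (incommensurable_inj (@h_incomm d')).
    transitivity (h C); first by rewrite hC natrD; ring.
    by rewrite hCD hD natrD; ring.
  have [m0 n0] : m = 0%N /\ n' = 0%N by lia.
  case: cC => [[+ _ _]|[_ _ ->]|[+ _]]; rewrite ?m0 //.
  by case: cD => [[_ _ ->]|[_ + _]|[_ +]]; rewrite ?n0.
elim: t t' d => [|c t IH] [|c' t'] d hd hA hB hAB.
- exact: nil hd hA hB hAB.
- exact: nil hd hA hB hAB.
- by apply: esym; exact: nil hd hB hA (esym hAB).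
have [hdl hdr] := rising_turn fM hd.
case: c c' hA hB => -[] hA hB.
- exact: IH hdl hA hB hAB.
- exact: mixed hd hA hB hAB.
- by apply: esym; exact: mixed hd hB hA (esym hAB).
- exact: IH hdr hA hB hAB.
Qed.

End AdditiveLabelling.

(** * Rational and irrational leveling topographs *)

Section Rho.
Variables (R : realType) (T : plane_tree) (f : region T -> R).
Implicit Types (d e : dart T) (A B : region T).
Hypotheses (fM : is_markov f) (fL : has_form Leveling f).

Let D4 d : discr f d = 4. Proof. by case: fL => /(_ d). Qed.
Let f2 : forall A, 2 <= f A := leveling_ge2 fL.
Let nonconstant : ~ has_form Constant f := leveling_nonconstant fL.
Let h A := rho (f A).

Let h_ge0 A : 0 <= h A. Proof. by have [] := rho_spec (f2 A). Qed.
Let hE A : f A = cosh2 (h A). Proof. by have [_ ->] := rho_spec (f2 A). Qed.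

Let h_gt0 A : 2 < f A -> 0 < h A.
Proof.
move=> fA; rewrite lt_neqAle h_ge0 andbT; apply/eqP => h0.
by move: fA; rewrite hE -h0 cosh20 ltxx.
Qed.

Lemma ends_cosh2 d :
  (f (ahead d) = cosh2 (h (lreg d) + h (rreg d)) /\
   f (behind d) = cosh2 (h (lreg d) - h (rreg d))) \/
  (f (ahead d) = cosh2 (h (lreg d) - h (rreg d)) /\
   f (behind d) = cosh2 (h (lreg d) + h (rreg d))).
Proof.
have hS := fM d; have hD := D4 d; rewrite discrE in hD.
rewrite (hE (lreg d)) (hE (rreg d)) in hS hD.
have hM := cosh2M (h (lreg d)) (h (rreg d)).
have hC := cosh2_conj (h (lreg d)) (h (rreg d)).
move: (f (ahead d)) (f (behind d)) (cosh2 (h (lreg d) + h (rreg d)))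
  (cosh2 (h (lreg d) - h (rreg d))) hS hD hM hC => a b p q hS hD hM hC.
have /eqP : (a - p) * (a - q) = 0.
  transitivity (a * a - a * (p + q) + p * q); first by ring.
  have aE : a = cosh2 (h (lreg d)) * cosh2 (h (rreg d)) - b by lra.
  by rewrite -hM hC aE; lra.
by rewrite mulf_eq0 !subr_eq0 => /orP[] /eqP aE; [left|right]; split=> //; lra.
Qed.

Lemma rising_rho d : rising f d -> h (ahead d) = h (lreg d) + h (rreg d).
Proof.
move=> [_ _]; rewrite /elabel => he.
case: (ends_cosh2 d) => -[ha hb]; last first.
  by have := cosh2_sub_le (h_ge0 (lreg d)) (h_ge0 (rreg d)); rewrite -ha -hb; lra.
by rewrite /h ha rho_cosh2 ger0_norm// addr_ge0.
Qed.

(** The third value at the vertex is [|h l + h r|] or [|h l - h r|]. By connectedness, one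
    commensurable pair of neighbours makes all of them commensurable. *)
Lemma commensurable_nxt d : commensurable (h (lreg d)) (h (rreg d)) ->
  commensurable (h (lreg (nxt d))) (h (rreg (nxt d))).
Proof.
rewrite !regE => hc.
have hN x : commensurable (h (rreg d)) x -> commensurable (h (rreg d)) `|x|.
  by move=> hx; have [//|_] := ger0P x; exact: commensurable_opp.
have hadd := commensurable_add hc.
have hsub : commensurable (h (rreg d)) (h (lreg d) - h (rreg d)).
  have := commensurable_opp (commensurable_sym hc) => /commensurable_sym.
  by move=> /commensurable_add /commensurable_opp; rewrite opprD opprK addrC.
by case: (ends_cosh2 d) => -[_ hb]; rewrite {2}/h hb rho_cosh2; exact: hN.
Qed.

Lemma rational_or_irrational : rational_topograph f \/ irrational_topograph f.
Proof.
pose C d := commensurable (h (lreg d)) (h (rreg d)).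
have Crev d : C d -> C (drev d) by rewrite /C !regE; exact: commensurable_sym.
have Cnxt d : C d -> C (nxt d) := @commensurable_nxt d.
have [[d Cd]|H] := pselect (exists d, C d); [left|right] => e hl hr.
  apply/commensurable_rational; [exact: h_gt0|exact: h_gt0|].
  exact: (dart_connected_ind (P := C) Cd Crev Cnxt).
by move/commensurable_rational => he; apply: H; exists e; apply: he; exact: h_gt0.
Qed.

(* Subtracting the smaller of two adjacent [rho]-values from the larger one,
   as in the Euclidean algorithm, eventually gives 0. *)
Lemma euclid_two_region n (p q : nat) (g : R) d : (p + q <= n)%N ->
  h (lreg d) = p%:R * g -> h (rreg d) = q%:R * g -> exists A, f A = 2.
Proof.
elim: n p q d => [|n IH] p q d.
  rewrite leqn0 addn_eq0 => /andP[/eqP -> _] hl _.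
  by exists (lreg d); rewrite hE hl mul0r cosh20.
have [->|p0] := posnP p; first by move=> _ hl _; exists (lreg d); rewrite hE hl mul0r cosh20.
have [->|q0] := posnP q; first by move=> _ _ hr; exists (rreg d); rewrite hE hr mul0r cosh20.
move=> pqn hl hr.
(* Up to reversing [d], the difference of the side values lies ahead. *)
wlog ha : d p q p0 q0 pqn hl hr / f (ahead d) = cosh2 (h (lreg d) - h (rreg d)).
  move=> H; case: (ends_cosh2 d) => -[ha hb]; last exact: (H d p q).
  apply: (H (drev d) q p); rewrite ?regE //; first by rewrite addnC.
  by rewrite hb -cosh2_opp opprB.
have g0 : 0 <= g.
  by have := h_ge0 (lreg d); rewrite hl pmulr_rge0// ltr0n.
have {}ha : h (ahead d) = `|p%:R - q%:R| * g.
  by rewrite {1}/h ha rho_cosh2 hl hr -mulrBl normrM (ger0_norm g0).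
have [pq|/ltnW qp] := leqP q p.
  apply: (IH (p - q)%N q (turnr d)); rewrite ?regE //; first by lia.
  by rewrite ha natrB// ger0_norm// subr_ge0 ler_nat.
apply: (IH p (q - p)%N (turnl d)); rewrite ?regE //; first by lia.
by rewrite ha natrB// distrC ger0_norm// subr_ge0 ler_nat.
Qed.

Lemma rational_ratio x y : 0 < x -> 0 < y -> rational (x / y :> R) ->
  exists (p q : nat) (g : R), [/\ (0 < p)%N, (0 < q)%N, x = p%:R * g & y = q%:R * g].
Proof.
move=> x0 y0 /rationalP[a [b hab]].
have ab0 : 0 < a%:~R / b%:R :> R by rewrite -hab divr_gt0.
have b0 : (0 < b)%N.
  by rewrite lt0n; apply/eqP => b0; rewrite b0 invr0 mulr0 ltxx in ab0.
have bR : (0 : R) < b%:R by rewrite ltr0n.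
have a0 : 0 < a by move: ab0; rewrite pmulr_lgt0 ?invr_gt0// ltr0z.
exists `|a|%N, b, (y / b%:R); split=> //.
- by rewrite absz_gt0 gt_eqF.
- rewrite pmulrn gez0_abs ?ltW// mulrCA -[x](@divfK _ y) ?gt_eqF// hab; ring.
- by rewrite mulrC divfK// gt_eqF.
Qed.

(** Turning away from a 2-region gives a rising dart. If there is none nearby, one of the two turns
    rises: [l a <= 2r] and [a r <= 2l] would give [a^2 l <= 4l], against [a > 2]. *)
Lemma rising_exists d : exists2 e, away d e & rising f e.
Proof.
have awl := away_left (away_root d); have awr := away_right (away_root d).
have [hl|/(ge2_gt2 f2) hl] := pselect (f (lreg d) = 2).
  exists (turnr d) => //; apply: beside_two_rising => //.
  exact: two_neighbour_gt2.
have [hr|/(ge2_gt2 f2) hr] := pselect (f (rreg d) = 2).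
  by exists (turnl d) => //; exact: beside_two_rising_r.
have [ha|/(ge2_gt2 f2) ha] := pselect (f (ahead d) = 2).
  exists (turnl (turnl d)); first exact: away_left.
  by apply: beside_two_rising_r; rewrite ?regE.
have [hl'|hl'] := ltP 0 (elabel f (turnl d)).
  by exists (turnl d) => //; rewrite /rising !regE.
exists (turnr d) => //; rewrite /rising !regE; split=> //.
move: hl'; rewrite (elabel_turnl _ fM) (elabel_turnr _ fM).
move: (f (lreg d)) (f (rreg d)) (f (ahead d)) hl hr ha => l r a hl hr ha h1.
have h3 : 0 < (a - 2) * (a + 2) * l by rewrite !mulr_gt0//; lra.
rewrite ltNge; apply/negP => h2.
have h4 : 0 <= a * (2 * r - l * a) by rewrite mulr_ge0//; lra.
by lra.
Qed.

Lemma rational_two_region : rational_topograph f -> exists A, f A = 2.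
Proof.
move=> fQ; have [d0] := dart_inhabited T; have [d _ [hl hr _]] := rising_exists d0.
have [p [q [g [_ _ hp hq]]]] := rational_ratio (h_gt0 hl) (h_gt0 hr) (fQ d hl hr).
exact: (@euclid_two_region (p + q) p q g d).
Qed.

Lemma iter_turnl d n : rising f d -> let e := iter n (@turnl T) d in
  [/\ rising f e, away d e, lreg e = lreg d
    & h (rreg e) = n%:R * h (lreg d) + h (rreg d)].
Proof.
move=> hd; elim: n => [|n [h1 h2 h3 h4]] /=.
  by split=> //; [exact: away_root|rewrite mul0r add0r].
split; rewrite ?regE //; [by have [] := rising_turn fM h1|exact: away_left|].
by rewrite rising_rho// h3 h4 -addn1 natrD; ring.
Qed.

Lemma iter_turnr d n : rising f d -> let e := iter n (@turnr T) d in
  [/\ rising f e, away d e, rreg e = rreg d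
    & h (lreg e) = h (lreg d) + n%:R * h (rreg d)].
Proof.
move=> hd; elim: n => [|n [h1 h2 h3 h4]] /=.
  by split=> //; [exact: away_root|rewrite mul0r addr0].
split; rewrite ?regE //; [by have [] := rising_turn fM h1|exact: away_right|].
by rewrite rising_rho// h3 h4 -addn1 natrD; ring.
Qed.

Lemma rational_repeated d : rational_topograph f ->
  exists A B, [/\ subtree_region d A, subtree_region d B, A <> B & f A = f B].
Proof.
move=> fQ; have [e de he] := rising_exists d; have [hl hr _] := he.
have [p [q [g [p0 q0 hp hq]]]] := rational_ratio (h_gt0 hl) (h_gt0 hr) (fQ e hl hr).
case: p p0 hp => // p _ hp.
(* Here [p] is one less than before; both regions receive the value [(p.+1 + q + p.+1 * q) * g]. *)
have [_ ea _ hA] := iter_turnr p.+2 he; have [_ eb _ hB] := iter_turnl q.+1 he.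
exists (lreg (iter p.+2 (@turnr T) e)), (rreg (iter q.+1 (@turnl T) e)); split.
- by exists (iter p.+2 (@turnr T) e); [exact: away_trans ea|left].
- by exists (iter q.+1 (@turnl T) e); [exact: away_trans eb|right].
- exact: (fan_regions_neq R).
- rewrite (hE (lreg _)) (hE (rreg _)); congr cosh2; rewrite hA hB hp hq.
  by rewrite -(addn1 p.+1) -(addn1 q) !natrD; ring.
Qed.

Section Irrational.
Hypothesis f_irr : irrational_topograph f.

(** Consecutive neighbours of a 2-region carry equal labels, and the ratio 1 is rational. *)
Lemma irrational_neq2 A : f A <> 2.
Proof.
have [d <-] := lreg_surj A => hl.
have hr := two_neighbour_gt2 fM D4 f2 nonconstant hl.
have [/(_ hl) [ha _] _] := discr4_beside fM (D4 d).
apply: (f_irr (d := turnr d)); rewrite ?regE ?ha //.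
by rewrite divff; [exists 1 => //; exact: rmorph1|rewrite gt_eqF// h_gt0].
Qed.

Let f_gt2 A : 2 < f A. Proof. exact: ge2_gt2 (@irrational_neq2 A). Qed.

Lemma irrational_incommensurable d : ~ commensurable (h (lreg d)) (h (rreg d)).
Proof.
by move=> /commensurable_rational hc; apply: (f_irr (f_gt2 _) (f_gt2 _));
  apply: hc; exact: h_gt0.
Qed.

(** Edge labels are nonzero, and three outgoing edges would be a vertex well, with [D < 4]. So
    another edge at the origin points in. *)
Lemma rising_pred d : rising f d ->
  exists2 d', rising f d' & d = turnl d' \/ d = turnr d'.
Proof.
move=> [_ _ h1].
have rev_rising e : elabel f e < 0 -> rising f (drev e).
  by move=> he; rewrite /rising !regE elabel_rev; split; [exact: f_gt2|exact: f_gt2|lra].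
have el0 e : elabel f e <> 0.
  move=> e0; have := elabel_sqr e fM; rewrite e0 (D4 e) subrr mulr0 addr0 expr0n /=.
  have := f_gt2 (lreg e); have := f_gt2 (rreg e) => hr hl.
  have : 0 < (f (lreg e) ^+ 2 - 4) * (f (rreg e) ^+ 2 - 4) by rewrite mulr_gt0//; nra.
  by lra.
have [h2|h2|/el0//] := ltgtP (elabel f (nxt d)) 0.
  exists (drev (nxt d)); first exact: rev_rising.
  by right; rewrite /turnr drevK nxt3.
have [h3|h3|/el0//] := ltgtP (elabel f (nxt (nxt d))) 0.
  exists (drev (nxt (nxt d))); first exact: rev_rising.
  by left; rewrite /turnl drevK nxt3.
have := D4 d; rewrite discrE.
move: h1 h2 h3; rewrite (elabel_behind _ fM) (elabel_nxt _ fM) (elabel_nxt2 _ fM).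
move=> h1 h2 h3; have := @vertex_ineq_strict R (f (lreg d)) (f (rreg d))
  (f (behind d)) (f2 _) (f2 _) (f2 _).
by lra.
Qed.

(** Whenever a walk leaves the rising subtree at its root, the root is moved back by
    [rising_pred]. *)
Lemma rising_ancestor d e : rising f d ->
  exists d', [/\ rising f d', away d' d & away d' e \/ away d' (drev e)].
Proof.
move=> hd; move: e; apply: (dart_connected_ind (d := d)).
- by exists d; split=> //; [exact: away_root|left; exact: away_root].
- by move=> e [d' [h1 h2 h3]]; exists d'; split=> //; rewrite drevK; case: h3; [right|left].
move=> e [d' [h1 h2 [h3|h3]]]; last first.
  by exists d'; split=> //; left; rewrite -[e]drevK; exact: away_left.
have [->|h4] := away_nxt h3; last by exists d'.
have [d'' h5 h6] := rising_pred h1; exists d''; split=> //.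
  apply: away_trans h2; case: h6 => ->; constructor; exact: away_root.
case: h6 => ->; [left; exact: (away_right (away_root _))|right].
by rewrite /turnr nxt3 drevK; exact: away_root.
Qed.

Lemma irrational_inj A B : f A = f B -> A = B.
Proof.
move=> fAB; have [d0] := dart_inhabited T.
have [eA hA] := lreg_surj A; have [eB hB] := lreg_surj B.
have [d1 _ hd1] := rising_exists d0.
have [d2 [hd2 _ h2]] := rising_ancestor eA hd1.
have [d3 [hd3 h32 h3]] := rising_ancestor eB hd2.
have sideP e C : lreg e = C -> away d3 e \/ away d3 (drev e) -> exists t, side d3 t C.
  move=> <- [/away_turns[t ht]|/away_turns[t ht]]; exists t.
    by left; rewrite -ht.
  by right; rewrite -ht regE.
have [tA sA] : exists t, side d3 t A.
  by apply: (sideP _ _ hA); case: h2 => h2; [left|right]; exact: away_trans h2.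
have [tB sB] := sideP _ _ hB h3.
by apply: (side_inj fM rising_rho irrational_incommensurable hd3 sA sB); rewrite /h fAB.
Qed.

End Irrational.
End Rho.

Unset Implicit Arguments.

Theorem theorem11p1 (R : realType) (T : plane_tree) (f : region T -> R)
    (f_markov : is_markov f) (f_range : forall A, f A <= -2 \/ 2 <= f A) :
  (exists! k : kind, has_form_up_to_sign k f) /\
  (has_form Well f ->
     (forall d, discr f d < 4) /\ (forall A, f A <> 2)) /\
  (has_form Constant f -> forall d, discr f d = 4) /\
  (has_form Leveling f ->
     (rational_topograph f \/ irrational_topograph f) /\
     (rational_topograph f ->
        (exists! A, f A = 2) /\
        (forall d, exists A B,
           [/\ subtree_region d A, subtree_region d B, A <> B & f A = f B])) /\
     (irrational_topograph f ->
        (forall A, f A <> 2) /\ (forall A B, f A = f B -> A = B))) /\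
  (forall w, negative_vertex_well f w ->
     (forall d, 20 <= discr f d) /\
     (forall A, `|f A| = 2 ->
        [\/ A = lreg w, A = lreg (nxt w) | A = lreg (nxt (nxt w))])).
Proof.
split.
  have [k hk] := form_exists f_markov f_range.
  by exists k; split=> // k'; exact: form_unique hk.
split.
  move=> fW; split=> [d|A]; first exact: well_discr.
  by have [d] := dart_inhabited T; apply: (discr_lt4_neq2 (d := d)) => //; exact: well_discr.
split; first by move=> fC d; have [] := has_form_invariant d f_markov fC.
split; last first.
  move=> w hw; split=> [d|A]; first exact: negative_vertex_well_discr hw.
  exact: negative_vertex_well_two.
move=> fL; split; first exact: rational_or_irrational.
split=> [fQ|fI]; last first.
  by split; [exact: irrational_neq2|exact: irrational_inj].
split; last by move=> d; exact: rational_repeated.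
have [A hA] := rational_two_region f_markov fL fQ; exists A; split=> // B hB.
by case: fL => _ + _; exact.
Qed.
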